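(* Let $v(r)=\exp(-1/(1-r))$, $r\in[0,1[$, and let $1\le p\le\infty$. Then the space of multipliers $(H_v^\infty(\mathbb{D}),\ell_p)$ is the set of complex sequences $(\lambda_m)_{m=0}^\infty$ such that: (a) if $1\le p<2$, $$\Big(\sum_{n=2}^\infty\Big(\sum_{m=n^4+1}^{(n+1)^4}\Big(|\lambda_m|\,e^{n^2}\Big(1-\frac1{n^2}\Big)^{-m}\Big)^{\frac{2p}{2-p}}\Big)^{\frac{2-p}{2}}\Big)^{\frac1p}<\infty ;$$ (b) if $2\le p<\infty$, $$\Big(\sum_{n=2}^\infty\Big(\max_{n^4<m\le (n+1)^4}|\lambda_m|\,e^{n^2}\Big(1-\frac1{n^2}\Big)^{-m}\Big)^{p}\Big)^{\frac1p}<\infty ;$$ (c) if $p=\infty$, $$\sup_{n\ge 2}\Big(\max_{n^4<m\le (n+1)^4}|\lambda_m|\,e^{n^2}\Big(1-\frac1{n^2}\Big)^{-m}\Big)<\infty .$$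
   Context: $\mathbb{D}$ is the open unit disc in $\mathbb{C}$, and $v$ is extended to $\mathbb{D}$ by $v(z)=v(|z|)$. $H_v^\infty(\mathbb{D})$ is the Banach space of all analytic functions $f:\mathbb{D}\to\mathbb{C}$ with $\sup_{z\in\mathbb{D}}v(z)|f(z)|<\infty$. An analytic function $f(z)=\sum_{n=0}^\infty a_nz^n$ is identified with its sequence of Taylor coefficients $(a_n)_{n=0}^\infty$. For vector spaces $A$, $B$ of complex sequences containing all finitely supported sequences, the space of multipliers from $A$ into $B$ is $(A,B)=\{c=(c_n) : (c_na_n)\in B \text{ for all } (a_n)\in A\}$. $\ell_p$ denotes the usual space of ($p$-summable, or bounded if $p=\infty$) complex sequences indexed by $m\ge 0$. *)

(* Defs.v *)
From HB Require Import structures.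
From mathcomp Require Import all_boot all_order all_algebra.
From mathcomp Require Export complex.
From mathcomp Require Import all_classical all_reals all_analysis.

Set Implicit Arguments.
Unset Strict Implicit.
Unset Printing Implicit Defensive.

Import Order.TTheory GRing.Theory Num.Theory.
Import numFieldNormedType.Exports.

Local Open Scope classical_set_scope.
Local Open Scope ring_scope.
Local Open Scope complex_scope.

(* The modulus of a complex number as an element of R; the norm `|z| of the
   field R[i] takes its values in R[i]. *)
Notation cabs := ComplexField.Normc.normc.

Definition disc (R : realType) : set R[i] := [set z | cabs z < 1].

(* Derivability in the direction 1, the scalars ranging over R[i], is complex
   differentiability. *)
Definition holomorphic_on (R : realType) (D : set R[i]) (f : R[i] -> R[i]) :=
  forall z, D z -> derivable (f : R[i]^o -> R[i]^o) z 1.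

Definition Hinfty (R : realType) (v : R -> R) : set (R[i] -> R[i]) :=
  [set f | holomorphic_on (@disc R) f /\
           has_ubound [set v (cabs z) * cabs (f z) | z in @disc R]].

Definition taylor_coefs (R : realType) (A : set (R[i] -> R[i])) :
    set (nat -> R[i]) :=
  [set a | exists2 f, A f & forall z, disc z ->
    series (fun n => a n * z ^+ n : R[i]^o) @ \oo --> (f z : R[i]^o)].

Definition ell (R : realType) (p : \bar R) : set (nat -> R[i]) :=
  [set a | (Lnorm (@counting nat R) p (fun m => (cabs (a m))%:E) < +oo)%E].

Definition multipliers (R : realType) (A B : set (nat -> R[i])) :
    set (nat -> R[i]) :=
  [set c | forall a, A a -> B (fun n => c n * a n)].

Definition weight (R : realType) (r : R) : R := expR (- (1 / (1 - r))).

Definition wcoef (R : realType) (lam : nat -> R[i]) (n m : nat) : R :=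
  cabs (lam m) * expR (n%:R ^+ 2) * (1 - 1 / n%:R ^+ 2) ^- m.

(* Main.v *)
(** For m in the n-th block n^4 < m <= (n+1)^4 let w_m = e^(n^2) (1 - 1/n^2)^(-m), so
    that [wcoef] is c_m = |lambda_m| w_m; write a_m = w_m b_m for the Taylor coefficients
    of f.

    Parseval's inequality on the circle of radius 1 - 1/n^2, where 1/v = e^(n^2), gives
    sum |b_m|^2 <= ||f||^2 over the n-th block, so Hoelder's inequality on each block shows
    that the stated conditions are sufficient.

    Conversely, r^m v(r) with m in the n-th block is, in the variable y = (1 - r)^(-1/2), a
    bump of bounded width around y = n.  Hence polynomials P_n that are uniformly bounded on
    the unit circle and have their frequencies near the n-th block can be glued into a
    function of H_v^infty with b_m = (P_n)_m on the blocks of even (or of odd) index; two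
    parities are needed because the spectra of neighbouring P_n overlap.  For p >= 2 one
    takes for P_n the monomial at which c_m is maximal.  For p < 2 one needs a bounded P_n
    whose coefficients are, in the mean, as large as a prescribed vector b of l^2-norm 1:
    take a random sum of +-b_m z^m, truncate its values smoothly, which changes each
    coefficient only by a factor in [1/2, 3/2] on average, and localize the spectrum by
    a de la Vallee-Poussin kernel.  All averages over circles are taken over roots of
    unity. *)

Require Import Defs.
From mathcomp Require Import all_boot all_order all_algebra.
From mathcomp Require Import all_classical all_reals all_analysis.
From mathcomp Require Import ess_sup_inf.
From mathcomp Require Import all_solvable all_field ring lra zify.

Set Implicit Arguments.
Unset Strict Implicit.
Unset Printing Implicit Defensive.

Import Order.TTheory GRing.Theory Num.Theory.
Import numFieldNormedType.Exports.
Local Open Scope classical_set_scope.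
Local Open Scope ring_scope.
Local Open Scope complex_scope.

(** * The real-valued modulus on R[i] *)

Section ComplexModulus.
Variable R : realType.
Implicit Types (z w : R[i]) (x : R).

Lemma cabsE z : `|z| = (cabs z)%:C.
Proof. by case: z. Qed.

Lemma cabs_ge0 z : 0 <= cabs z.
Proof. by case: z => a b; exact: sqrtr_ge0. Qed.

Lemma cabs0 : cabs (0 : R[i]) = 0. Proof. exact: ComplexField.Normc.normc0. Qed.
Lemma cabs1 : cabs (1 : R[i]) = 1. Proof. exact: ComplexField.Normc.normc1. Qed.
Lemma cabsM z w : cabs (z * w) = cabs z * cabs w.
Proof. exact: ComplexField.Normc.normcM. Qed.
Lemma cabsV z : cabs z^-1 = (cabs z)^-1.
Proof. exact: ComplexField.Normc.normcV. Qed.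
Lemma cabsN z : cabs (- z) = cabs z.
Proof. by apply: complexI; rewrite -!cabsE normrN. Qed.
Lemma cabsB z w : cabs (z - w) = cabs (w - z).
Proof. by rewrite -cabsN opprB. Qed.
Lemma cabsD z w : cabs (z + w) <= cabs z + cabs w.
Proof. by rewrite -lecR rmorphD /= -!cabsE ler_normD. Qed.
Lemma cabsX z n : cabs (z ^+ n) = cabs z ^+ n.
Proof. by apply: complexI; rewrite rmorphXn /= -!cabsE normrX. Qed.
Lemma cabs_real x : cabs x%:C = `|x|.
Proof. by rewrite /cabs /= expr0n /= addr0 sqrtr_sqr. Qed.
Lemma cabs_nat n : cabs (n%:R : R[i]) = n%:R.
Proof. by rewrite -(rmorph_nat (real_complex R)) cabs_real normr_nat. Qed.
Lemma cabs_eq0 z : (cabs z == 0) = (z == 0).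
Proof.
by apply/eqP/eqP => [/ComplexField.Normc.eq0_normc //|->]; rewrite cabs0.
Qed.
Lemma cabs_sum (I : Type) (r : seq I) (P : pred I) (F : I -> R[i]) :
  cabs (\sum_(i <- r | P i) F i) <= \sum_(i <- r | P i) cabs (F i).
Proof.
elim/big_rec2: _ => [|i y x _ h]; first by rewrite cabs0.
by apply: (le_trans (cabsD _ _)); rewrite lerD2l.
Qed.
Lemma cabs_le_Re_Im z : cabs z <= `|complex.Re z| + `|complex.Im z|.
Proof.
rewrite {1}[z]complexE (le_trans (cabsD _ _))// cabsM !cabs_real.
have -> : cabs ('i : R[i]) = 1 by rewrite /cabs /= expr0n /= add0r expr1n sqrtr1.
by rewrite mul1r.
Qed.
Lemma sqr_cabs z : (cabs z ^+ 2)%:C = z * z^*%C.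
Proof. by rewrite rmorphXn /= -cabsE sqr_normc. Qed.
Lemma Re_le_cabs z : `|complex.Re z| <= cabs z.
Proof. by rewrite -lecR -[X in _ <= X]cabsE normc_ge_Re. Qed.
Lemma Im_le_cabs z : `|complex.Im z| <= cabs z.
Proof.
have := Re_le_cabs (z * 'i); rewrite ReiNIm normrN cabsM.
have -> : cabs ('i : R[i]) = 1 by rewrite /cabs /= expr0n /= add0r expr1n sqrtr1.
by rewrite mulr1.
Qed.

Lemma Re_sum (I : Type) (r : seq I) (F : I -> R[i]) :
  complex.Re (\sum_(i <- r) F i) = \sum_(i <- r) complex.Re (F i).
Proof.
by elim/big_rec2: _ => [//|i x y _ <-]; case: (F i) y => [a b] [c d].
Qed.
Lemma Im_sum (I : Type) (r : seq I) (F : I -> R[i]) :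
  complex.Im (\sum_(i <- r) F i) = \sum_(i <- r) complex.Im (F i).
Proof.
by elim/big_rec2: _ => [//|i x y _ <-]; case: (F i) y => [a b] [c d].
Qed.

Lemma cabs_dist z w : cabs z <= cabs w + cabs (z - w).
Proof. by rewrite -{1}(subrK w z) addrC cabsD. Qed.

End ComplexModulus.

(** * Complex series dominated by geometric ones *)

Section ComplexSeries.
Variable R : realType.
Implicit Types (u : nat -> R[i]) (l : R[i]) (C q : R).

(** A positive element of R[i] is real, so real tolerances suffice. *)
Lemma ccvgP (u : nat -> R[i]) l :
  ((u : nat -> R[i]^o) @ \oo --> (l : R[i]^o)) <->
  (forall e : R, 0 < e -> exists N, forall n, (N <= n)%N -> cabs (u n - l) < e).
Proof.
split=> [/cvgrPdist_lt h e e0|h].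
  have e0' : 0 < e%:C by rewrite ltcR.
  have [N _ hN] := h _ e0'; exists N => n Nn.
  by have := hN n Nn; rewrite /= -ltcR -cabsE distrC.
apply/cvgrPdist_lt => e e0.
have eE : e = (complex.Re e)%:C by rewrite RRe_real // gtr0_real.
rewrite eE ltcR in e0.
have [N hN] := h _ e0; exists N => // n Nn /=.
by rewrite eE distrC cabsE ltcR; exact: hN.
Qed.

Lemma series_ord (u : nat -> R[i]^o) n : series u n = \sum_(i < n) u i.
Proof. by rewrite /series /= big_mkord. Qed.

Lemma geo_partial_le q (n m : nat) : 0 <= q < 1 ->
  \sum_(n <= i < m) q ^+ i <= q ^+ n / (1 - q).
Proof.
move=> /andP[q0 q1]; have q1' : 0 < 1 - q by lra.
have [mn|/ltnW nm] := leqP m n.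
  by rewrite big_geq // divr_ge0 ?exprn_ge0 // ltW.
rewrite ler_pdivlMr // mulr_suml.
rewrite (eq_bigr (fun i => (- q ^+ i.+1) - (- q ^+ i))); last first.
  by move=> i _; rewrite exprS; ring.
by rewrite telescope_sumr // opprK addrC lerBlDr lerDl exprn_ge0.
Qed.

Lemma geo_tail C q u l N : 0 <= q < 1 -> (forall m, cabs (u m) <= C * q ^+ m) ->
  (series (u : nat -> R[i]^o) @ \oo --> (l : R[i]^o)) ->
  cabs (l - \sum_(m < N) u m) <= C * (q ^+ N / (1 - q)).
Proof.
move=> q01 ub /ccvgP cl; apply/ler_addgt0Pr => e e0.
have [M hM] := cl e e0.
have := hM (maxn M N) (leq_maxl _ _); rewrite series_ord cabsB => /ltW hl.
have -> : l - \sum_(m < N) u m = (l - \sum_(m < maxn M N) u m) +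
    \sum_(N <= m < maxn M N) u m.
  rewrite -!(big_mkord xpredT u) (big_cat_nat (leq0n N) (leq_maxr M N)) /=.
  ring.
rewrite (le_trans (cabsD _ _)) // addrC lerD //.
apply: (le_trans (cabs_sum _ _ _)).
apply: (@le_trans _ _ (\sum_(N <= i < maxn M N) C * q ^+ i)); first by apply: ler_sum => i _; exact: ub.
rewrite -mulr_sumr ler_wpM2l //; last exact: geo_partial_le.
by have := le_trans (cabs_ge0 _) (ub 0%N); rewrite expr0 mulr1.
Qed.

Lemma geo_cvg_real C q (u : nat -> R) : 0 <= q < 1 ->
  (forall m, `|u m| <= C * q ^+ m) -> cvgn (series u).
Proof.
move=> /andP[q0 q1] ub; apply: normed_cvg.
apply: (@series_le_cvg _ _ (geometric C q)) => [n|n||n] //=.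
- by rewrite (le_trans _ (ub n)).
- by apply: is_cvg_geometric_series; rewrite ger0_norm.
Qed.

(** Real and imaginary parts are summed separately, each being absolutely convergent over R. *)
Lemma geo_cvg C q u : 0 <= q < 1 -> (forall m, cabs (u m) <= C * q ^+ m) ->
  exists l, series (u : nat -> R[i]^o) @ \oo --> (l : R[i]^o).
Proof.
move=> q01 ub.
have /cvg_ex[a /cvgrPdist_lt ha] : cvgn (series (fun m => complex.Re (u m))).
  by apply: (geo_cvg_real (C := C) q01) => m; exact: le_trans (Re_le_cabs _) (ub m).
have /cvg_ex[b /cvgrPdist_lt hb] : cvgn (series (fun m => complex.Im (u m))).
  by apply: (geo_cvg_real (C := C) q01) => m; exact: le_trans (Im_le_cabs _) (ub m).
exists (a +i* b); apply/ccvgP => e e0.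
have e20 : 0 < e / 2 by rewrite divr_gt0.
have [N1 _ h1] := ha _ e20; have [N2 _ h2] := hb _ e20.
exists (maxn N1 N2) => n; rewrite geq_max => /andP[/h1 /= k1 /h2 /= k2].
rewrite (le_lt_trans (cabs_le_Re_Im _)) // [ltRHS]splitr ltrD //.
  by rewrite distrC /series /= -Re_sum in k1; rewrite /series /=; move: k1; case: (\sum_(_ <= _ < _) _).
by rewrite distrC /series /= -Im_sum in k2; rewrite /series /=; move: k2; case: (\sum_(_ <= _ < _) _).
Qed.

Lemma geo_small K q (e : R) : 0 <= q < 1 -> 0 < e -> exists N, K * q ^+ N < e.
Proof.
move=> /andP[q0 q1] e0.
have /cvgrPdist_lt h : geometric K q @ \oo --> (0 : R).
  by apply: cvg_geometric; rewrite ger0_norm.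
have [N _ hN] := h _ e0; exists N.
have := hN N (leqnn N); rewrite /= sub0r normrN; apply: le_lt_trans.
exact: ler_norm.
Qed.

End ComplexSeries.

(** * Power series on the disc and their differentiability *)

Section PowerSeries.
Variable R : realType.
Implicit Types (a : nat -> R[i]) (f : R[i] -> R[i]).

Definition sum_on_disc a f := forall z : R[i], disc z ->
  series (fun n => a n * z ^+ n : R[i]^o) @ \oo --> (f z : R[i]^o).

(** Convergence at an intermediate radius s > r bounds a_m s^m; the geometric rate is then r / s. *)
Lemma coefs_geo a f (r : R) : sum_on_disc a f -> 0 <= r < 1 ->
  exists C q, 0 <= q < 1 /\ forall m, cabs (a m) * r ^+ m <= C * q ^+ m.
Proof.
move=> af /andP[r0 r1]; pose s := (1 + r) / 2.
have s0 : 0 < s by rewrite /s; lra.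
have s1 : s < 1 by rewrite /s; lra.
have rs : r < s by rewrite /s; lra.
have sd : @disc R s%:C by rewrite /disc; change (cabs s%:C < 1); rewrite cabs_real gtr0_norm.
have /ccvgP h := af _ sd; have [N hN] := h 1 ltr01.
pose u m := a m * s%:C ^+ m.
have uE m : cabs (u m) = cabs (a m) * s ^+ m.
  by rewrite cabsM cabsX cabs_real gtr0_norm.
(* From index [N] on, a term is the difference of two partial sums within 1 of the limit, whence the
   2; the sum covers the earlier terms. *)
exists (2 + \sum_(i < N) cabs (u i)), (r / s); split.
  by rewrite divr_ge0 ?(ltW s0) //= ltr_pdivrMr // mul1r.
move=> m; rewrite expr_div_n mulrA ler_pdivlMr ?exprn_gt0 //.
rewrite mulrAC -uE ler_wpM2r ?exprn_ge0 //.
have [Nm|mN] := leqP N m.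
  have h1 := hN m Nm; have h2 := hN m.+1 (leqW Nm).
  rewrite (@le_trans _ _ 2) ?lerDl ?sumr_ge0 // => [|i _]; last exact: cabs_ge0.
  have -> : u m = (series (fun n => a n * s%:C ^+ n : R[i]^o) m.+1 - f s%:C)
      - (series (fun n => a n * s%:C ^+ n : R[i]^o) m - f s%:C).
    by rewrite !series_ord big_ord_recr /= -/(u m); ring.
  rewrite (le_trans (cabsD _ _)) // cabsN.
  by rewrite (_ : 2 = 1 + 1) // lerD // ltW.
rewrite (bigD1 (Ordinal mN)) //= addrCA lerDl addr_ge0 // sumr_ge0 // => i _.
exact: cabs_ge0.
Qed.

(** The remainders E_m satisfy E_(m+1) = (x + d) E_m + m x^(m-1) d^2. The resulting bound m x^(m-1)
    d <= (x + d)^m dominates the differentiated series. *)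
Lemma pow_taylor_ge0 (x d : R) m : 0 <= x -> 0 <= d ->
  0 <= (x + d) ^+ m - x ^+ m - m%:R * x ^+ m.-1 * d.
Proof.
move=> x0 d0; elim: m => [|m IH]; first by rewrite !expr0 mul0r mul0r; lra.
have -> : (x + d) ^+ m.+1 - x ^+ m.+1 - m.+1%:R * x ^+ m.+1.-1 * d =
  (x + d) * ((x + d) ^+ m - x ^+ m - m%:R * x ^+ m.-1 * d) +
  m%:R * x ^+ m.-1 * d ^+ 2.
  case: m {IH} => [|m] /=; first by rewrite !expr0 !expr1; ring.
  by rewrite !exprS -!natr1; ring.
apply: addr_ge0; apply: mulr_ge0 => //; first exact: addr_ge0.
  by rewrite mulr_ge0 ?ler0n ?exprn_ge0.
exact: exprn_ge0.
Qed.

(** The complex and the real remainder obey the same recursion and are compared by induction. The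
    bound is quadratic in h and summable against the coefficients as soon as |z| + d < 1. *)
Lemma pow_taylor (z h : R[i]) (d : R) m : 0 < d -> cabs h <= d ->
  cabs ((z + h) ^+ m - z ^+ m - m%:R * z ^+ m.-1 * h) <=
  (cabs h / d) ^+ 2 *
    ((cabs z + d) ^+ m - cabs z ^+ m - m%:R * cabs z ^+ m.-1 * d).
Proof.
move=> d0 hd; elim: m => [|m IH].
  by rewrite !expr0 !mul0r !subr0 !subrr cabs0 mulr0.
have -> : (z + h) ^+ m.+1 - z ^+ m.+1 - m.+1%:R * z ^+ m.+1.-1 * h =
  (z + h) * ((z + h) ^+ m - z ^+ m - m%:R * z ^+ m.-1 * h) +
  m%:R * z ^+ m.-1 * h ^+ 2.
  case: m {IH} => [|m] /=; first by rewrite !expr0 !expr1; ring.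
  by rewrite !exprS -!natr1; ring.
set x := cabs z in IH *; set k := cabs h in IH hd *.
have -> : (x + d) ^+ m.+1 - x ^+ m.+1 - m.+1%:R * x ^+ m.+1.-1 * d =
  (x + d) * ((x + d) ^+ m - x ^+ m - m%:R * x ^+ m.-1 * d) +
  m%:R * x ^+ m.-1 * d ^+ 2.
  case: m {IH} => [|m] /=; first by rewrite !expr0 !expr1; ring.
  by rewrite !exprS -!natr1; ring.
rewrite (le_trans (cabsD _ _)) // [leRHS]mulrDr lerD //.
  rewrite cabsM mulrCA ler_pM ?cabs_ge0 //.
  by rewrite (le_trans (cabsD _ _)) // lerD2l.
rewrite !cabsM !cabsX cabs_nat -/x -/k.
by rewrite le_eqVlt; apply/orP; left; apply/eqP; field; rewrite gt_eqF.
Qed.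

Lemma sum_on_disc_holo a f : sum_on_disc a f -> holomorphic_on (@disc R) f.
Proof.
move=> af z zd; rewrite /disc /= in zd.
have z0 : 0 <= cabs z := cabs_ge0 z.
pose d := (1 - cabs z) / 2; have d0 : 0 < d by rewrite /d; lra.
have [C [q [q01 hC]]] : exists C q, 0 <= q < 1 /\
    forall m, cabs (a m) * (cabs z + d) ^+ m <= C * q ^+ m.
  by apply: (coefs_geo af); rewrite /d; lra.
have [g hg] : exists g, series (fun m => a m * (m%:R * z ^+ m.-1) : R[i]^o)
    @ \oo --> (g : R[i]^o).
  apply: (geo_cvg (C := C / d) q01) => m.
  rewrite mulrAC ler_pdivlMr // (le_trans _ (hC m)) // !cabsM -mulrA cabs_nat cabsX.
  rewrite ler_wpM2l ?cabs_ge0 //.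
  have := pow_taylor_ge0 m z0 (ltW d0); have := exprn_ge0 m z0; lra.
(* Summing [pow_taylor] over all terms leaves an error O(|h|^2), so the termwise derivative [g] is
   the derivative of f. *)
have key h : cabs h < d -> cabs (f (z + h) - f z - h * g) <=
    (cabs h / d) ^+ 2 * (C / (1 - q)).
  move=> hd; pose u m := a m * ((z + h) ^+ m - z ^+ m - m%:R * z ^+ m.-1 * h).
  have zhd : disc (z + h).
    rewrite /disc; change (cabs (z + h) < 1); rewrite (le_lt_trans (cabsD _ _)) //.
    by rewrite /d in hd; lra.
  have ub m : cabs (u m) <= ((cabs h / d) ^+ 2 * C) * q ^+ m.
    rewrite cabsM -(mulrA (_ ^+ 2)) (le_trans (ler_wpM2l (cabs_ge0 _) (pow_taylor z m d0 (ltW hd)))) //.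
    rewrite mulrCA ler_wpM2l ?sqr_ge0 // (le_trans _ (hC m)) // ler_wpM2l ?cabs_ge0 //.
    rewrite -addrA gerDl -opprD oppr_le0 addr_ge0 ?exprn_ge0 //.
    by rewrite mulr_ge0 ?(ltW d0) // mulr_ge0 ?exprn_ge0.
  have uc : series (u : nat -> R[i]^o) @ \oo --> (f (z + h) - f z - h * g : R[i]^o).
    apply: cvg_trans (cvgB (cvgB (af _ zhd) (af _ zd)) (cvgM (cvg_cst (h : R[i]^o)) hg)).
    apply: near_eq_cvg; apply: nearW => n.
    transitivity (series (fun n : nat => a n * (z + h) ^+ n : R[i]^o) n -
      series (fun n : nat => a n * z ^+ n : R[i]^o) n -
      h * series (fun m : nat => a m * (m%:R * z ^+ m.-1) : R[i]^o) n); first by [].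
    rewrite !series_ord mulr_sumr -!sumrB; apply: eq_bigr => i _.
    by rewrite /u; ring.
  have := geo_tail 0 q01 ub uc.
  by rewrite big_ord0 subr0 expr0 mul1r mulrA.
apply/cvg_ex; exists g; apply/cvgrPdist_le => e e0.
have eE : e = (complex.Re e)%:C by rewrite RRe_real // gtr0_real.
rewrite eE ltcR in e0.
have [M M0 hM] : exists2 M, 0 < M & C / (1 - q) / d ^+ 2 <= M.
  by exists (`|C / (1 - q) / d ^+ 2| + 1); [rewrite ltr_wpDl | rewrite ler_wpDr // ler_norm].
near=> h.
have h0 : h != 0 by near: h; exact: nbhs_dnbhs_neq.
have hd : cabs h < d.
  rewrite -ltcR -cabsE; near: h; apply: dnbhs0_lt; by rewrite ltcR.
have he : cabs h < complex.Re e / M.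
  rewrite -ltcR -cabsE; near: h; apply: dnbhs0_lt; by rewrite ltcR divr_gt0.
have hp : 0 < cabs h by rewrite lt_def cabs_eq0 h0 cabs_ge0.
rewrite /= eE cabsE lecR cabsB.
have -> : h^-1 *: (f (h *: 1 + z) - f z) - g = h^-1 * (f (z + h) - f z - h * g).
  rewrite /GRing.scale /= mulr1 [h + z]addrC; field; exact: h0.
rewrite cabsM cabsV ler_pdivrMl //.
rewrite (le_trans (key _ hd)) // expr_div_n.
rewrite [X in X <= _](_ : _ = cabs h * (cabs h * (C / (1 - q) / d ^+ 2))); last by field; lra.
rewrite ler_wpM2l ?(ltW hp) // (le_trans (ler_wpM2l (ltW hp) hM)) //.
by rewrite -ler_pdivlMr // ltW.
Unshelve. all: by end_near. Qed.

End PowerSeries.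


(** * Parseval's identity over roots of unity *)

Section Parseval.
Variable R : realType.
Implicit Types (p : {poly R[i]}) (z w : R[i]).

(** Over the algebraically closed field R[i], X^N - 1 splits and is separable, so it has N distinct
    roots. *)
Lemma exists_prim_root N : (0 < N)%N -> exists w : R[i], N.-primitive_root w.
Proof.
move=> N0; have [r rE] := closed_field_poly_normal ('X^N - 1 : {poly R[i]}).
rewrite lead_coefXnsubC // scale1r in rE.
have ru : uniq r.
  by rewrite -separable_prod_XsubC -rE separable_Xn_sub_1 // pnatr_eq0 -lt0n.
have rN : all N.-unity_root r.
  by apply/allP => z zr; rewrite /root_of_unity rE root_prod_XsubC.
have rs : (N <= size r)%N.
  by have := size_prod_XsubC r id; rewrite -rE size_XnsubC // => -[->].
by have /hasP[w _ wp] := has_prim_root N0 rN ru rs; exists w.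
Qed.

Lemma cabs_prim_root N w : N.-primitive_root w -> cabs w = 1.
Proof.
move=> wp; have N0 := prim_order_gt0 wp.
have : cabs w ^+ N = 1 by rewrite -cabsX (prim_expr_order wp) cabs1.
by move/eqP; rewrite -[X in _ == X](expr1n _ N) eqrXn2 ?cabs_ge0 // => /eqP.
Qed.

Lemma conj_prim_root N w : N.-primitive_root w -> w * w^*%C = 1.
Proof. by move=> wp; rewrite -sqr_cabs (cabs_prim_root wp) expr1n. Qed.

(** The summands are powers of an N-th root of unity x; if x differs from 1, the factorization of
    x^N - 1 by x - 1 makes their sum vanish. *)
Lemma prim_root_orthogonal N w (i k : 'I_N) : N.-primitive_root w ->
  \sum_(j < N) (w ^+ i * w^*%C ^+ k) ^+ j = (i == k)%:R * N%:R.
Proof.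
move=> wp; have [->|ik] := eqVneq i k.
  rewrite mul1r -exprMn (conj_prim_root wp) expr1n.
  by under eq_bigr do rewrite expr1n; rewrite sumr_const card_ord.
rewrite mul0r; set x := _ * _.
have xN : x ^+ N = 1.
  rewrite exprMn -!exprM ![(_ * N)%N]mulnC !exprM (prim_expr_order wp).
  have -> : w^*%C ^+ N = (w ^+ N)^*%C by rewrite rmorphXn.
  by rewrite (prim_expr_order wp) rmorph1 !expr1n mulr1.
have x1 : x != 1.
  apply: contra_neq ik => x1; apply/val_inj/eqP.
  have : w ^+ i = w ^+ k.
    by rewrite -[RHS]mul1r -x1 /x -mulrA [_ * w ^+ k]mulrC -exprMn
       (conj_prim_root wp) expr1n mulr1.
  by move/eqP; rewrite (eq_prim_root_expr wp) !modn_small.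
have := subrXX x 1 N; rewrite xN expr1n subrr => /esym/eqP.
rewrite mulf_eq0 subr_eq0 (negbTE x1) /= => /eqP s0.
rewrite -[RHS]s0 (reindex_inj rev_ord_inj) /=; apply: eq_bigr => j _.
by rewrite expr1n mulr1 subnS predn_sub.
Qed.

(** The bound on [size p] keeps distinct frequencies distinct modulo [N], so that only diagonal
    terms survive. *)
Lemma parseval N w p z : N.-primitive_root w -> (size p <= N)%N ->
  \sum_(j < N) cabs p.[z * w ^+ j] ^+ 2 =
  N%:R * \sum_(m < N) (cabs p`_m * cabs z ^+ m) ^+ 2.
Proof.
move=> wp pN; apply: complexI; rewrite rmorph_sum rmorphM rmorph_sum /= rmorph_nat.
transitivity (\sum_(j < N) \sum_(m < N) \sum_(k < N)
    p`_m * z ^+ m * (p`_k * z ^+ k)^*%C * (w ^+ m * w^*%C ^+ k) ^+ j).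
  apply: eq_bigr => j _; rewrite sqr_cabs (horner_coef_wide _ pN) rmorph_sum /=.
  rewrite big_distrlr /=; apply: eq_bigr => m _; apply: eq_bigr => k _.
  rewrite !exprMn !rmorphM !rmorphXn /= -!exprM.
  rewrite [(j * m)%N]mulnC [(j * k)%N]mulnC.
  by rewrite [p`_m * (_ * _)]mulrA [X in _ * X]mulrA mulrACA.
rewrite exchange_big mulr_sumr; apply: eq_bigr => m _ /=.
rewrite exchange_big (bigD1 m) //= [X in _ + X]big1 ?addr0 => [|k km].
  rewrite -mulr_sumr (prim_root_orthogonal _ _ wp) eqxx mul1r mulrC.
  by rewrite -cabsX -cabsM sqr_cabs.
by rewrite -mulr_sumr (prim_root_orthogonal _ _ wp) eq_sym (negbTE km) mul0r mulr0.
Qed.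

Lemma parseval_le p (r B : R) M : 0 <= r ->
  (forall z, cabs z = r -> cabs p.[z] <= B) ->
  \sum_(m < M) (cabs p`_m * r ^+ m) ^+ 2 <= B ^+ 2.
Proof.
move=> r0 pB; pose N := (maxn (size p) M).+1.
have [w wp] := @exists_prim_root N isT.
have rE : cabs (r%:C : R[i]) = r by rewrite cabs_real ger0_norm.
have B0 : 0 <= B by apply: le_trans (cabs_ge0 _) (pB _ rE).
have sN : (size p <= N)%N by rewrite leqW // leq_maxl.
have := parseval (r%:C) wp sN; rewrite rE => pE.
have MN : (M <= N)%N by rewrite leqW // leq_maxr.
have N0 : 0 < N%:R :> R by rewrite ltr0n.
rewrite (@le_trans _ _ (\sum_(m < N) (cabs p`_m * r ^+ m) ^+ 2)) //.
  rewrite -!(big_mkord xpredT (fun m => (cabs p`_m * r ^+ m) ^+ 2)).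
  rewrite [leRHS](big_cat_nat (leq0n M) MN) /= lerDl sumr_ge0 // => i _.
  exact: sqr_ge0.
rewrite -(ler_pM2l N0) -pE.
apply: (@le_trans _ _ (\sum_(j < N) B ^+ 2)).
  apply: ler_sum => j _; rewrite lerXn2r ?nnegrE ?cabs_ge0 // pB //.
  by rewrite cabsM cabsX (cabs_prim_root wp) expr1n mulr1.
by rewrite sumr_const card_ord mulr_natl.
Qed.

Lemma parseval_coef_le p (r B : R) m : 0 <= r ->
  (forall z, cabs z = r -> cabs p.[z] <= B) -> cabs p`_m * r ^+ m <= B.
Proof.
move=> r0 pB; have := @parseval_le p r B m.+1 r0 pB.
rewrite big_ord_recr /= => h.
have B0 : 0 <= B by apply: le_trans (cabs_ge0 _) (pB r%:C _); rewrite cabs_real ger0_norm.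
rewrite -(@ler_pXn2r _ 2) ?nnegrE ?mulr_ge0 ?cabs_ge0 ?exprn_ge0 //.
by apply: le_trans h; rewrite lerDr sumr_ge0 // => i _; exact: sqr_ge0.
Qed.

(** A long Taylor polynomial is within d of f on the whole circle, so the polynomial case applies
    with bound B + d, and d is arbitrary. *)
Lemma parseval_sum_on_disc a f (r B : R) M : 0 <= r < 1 -> sum_on_disc a f ->
  (forall z, cabs z = r -> cabs (f z) <= B) ->
  \sum_(m < M) (cabs (a m) * r ^+ m) ^+ 2 <= B ^+ 2.
Proof.
move=> r01 af fB; have /andP[r0 r1] := r01.
have B0 : 0 <= B by apply: le_trans (cabs_ge0 _) (fB r%:C _); rewrite cabs_real ger0_norm.
have [C [q [q01 hC]]] := coefs_geo af r01.
apply/ler_addgt0Pr => e e0.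
have [d d0 hd] : exists2 d, 0 < d & (B + d) ^+ 2 <= B ^+ 2 + e.
  (* As d <= 1, the increase 2 B d + d^2 is at most d (2 B + 1) <= e. *)
  exists (Num.min 1 (e / (2 * B + 1))).
    by rewrite lt_min ltr01 divr_gt0 //; lra.
  set d := Num.min _ _.
  have d1 : d <= 1 by rewrite ge_min lexx.
  have de : d * (2 * B + 1) <= e by rewrite -ler_pdivlMr ?ge_min ?lexx ?orbT //; lra.
  have d0 : 0 <= d by rewrite le_min ler01 divr_ge0 ?(ltW e0) //; lra.
  have dd : d ^+ 2 <= d by rewrite expr2 ler_piMr.
  by rewrite sqrrD -addrA lerD2l; lra.
have [N0 hN0] := geo_small (C / (1 - q)) q01 d0.
pose N := maxn N0 M.
pose p : {poly R[i]} := \poly_(i < N) a i.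
have pB z : cabs z = r -> cabs p.[z] <= B + d.
  move=> zr; have zd : disc z by rewrite /disc; change (cabs z < 1); rewrite zr.
  have -> : p.[z] = \sum_(m < N) a m * z ^+ m by rewrite horner_poly.
  rewrite (le_trans (cabs_dist _ (f z))) // lerD ?fB // cabsB.
  have ub m : cabs (a m * z ^+ m) <= C * q ^+ m by rewrite cabsM cabsX zr.
  rewrite (le_trans (geo_tail N q01 ub (af z zd))) // (le_trans _ (ltW hN0)) //.
  have C0 : 0 <= C by have := le_trans (cabs_ge0 _) (ub 0%N); rewrite expr0 mulr1.
  have /andP[q0 q1] := q01.
  rewrite mulrCA mulrC ler_wpM2l ?divr_ge0 //; first by lra.
  by rewrite ler_wiXn2l ?leq_maxl // ltW.
apply: le_trans hd; apply: le_trans (@parseval_le p r (B + d) M r0 pB).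
apply: ler_sum => m _; rewrite coef_poly.
by have -> : (m < N)%N by rewrite (leq_trans (ltn_ord m)) // leq_maxr.
Qed.

End Parseval.

(** * Limits of polynomials bounded in the weighted norm *)

Section NormalFamily.
Variable R : realType.
Implicit Types (F : nat -> {poly R[i]}) (v : R -> R).

(* Parseval bounds the coefficients of all [F N] geometrically, uniformly in [N]; this is
   what replaces a normal family argument. *)
Lemma taylor_coefs_Hinfty_lim v F (C : R) a :
  (forall r, 0 <= r < 1 -> 0 < v r) ->
  (forall N z, disc z -> v (cabs z) * cabs (F N).[z] <= C) ->
  (forall N m, (m < N)%N -> (F N)`_m = a m) ->
  taylor_coefs (Hinfty v) a.
Proof.
move=> v0 Fb Fa.
have geo (r : R) : 0 <= r < 1 -> exists K q, [/\ 0 <= q < 1,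
    forall m, cabs (a m) * r ^+ m <= K * q ^+ m &
    forall N m, cabs (F N)`_m * r ^+ m <= K * q ^+ m].
  move=> /andP[r0 r1]; pose s := (1 + r) / 2.
  have s0 : 0 < s by rewrite /s; lra.
  have s1 : s < 1 by rewrite /s; lra.
  have rs : r < s by rewrite /s; lra.
  have vs : 0 < v s by apply: v0; rewrite (ltW s0) s1.
  have FK N m : cabs (F N)`_m * r ^+ m <= C / v s * (r / s) ^+ m.
    rewrite expr_div_n mulrA ler_pdivlMr ?exprn_gt0 // mulrAC ler_wpM2r ?exprn_ge0 //.
    apply: parseval_coef_le => [|z zs]; first exact: ltW.
    have zd : disc z by rewrite /disc; change (cabs z < 1); rewrite zs.
    by rewrite ler_pdivlMr // mulrC -zs; exact: Fb.
  exists (C / v s), (r / s); split=> //.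
    by rewrite divr_ge0 ?(ltW s0) //= ltr_pdivrMr // mul1r.
  by move=> m; rewrite -(Fa m.+1 m) //; exact: FK.
pose S z : nat -> R[i]^o := series (fun n => a n * z ^+ n : R[i]^o).
pose f z : R[i] := lim (S z @ \oo).
have geoz z : disc z -> exists K q, [/\ 0 <= q < 1,
    forall m, cabs (a m * z ^+ m) <= K * q ^+ m &
    forall N m, cabs ((F N)`_m * z ^+ m) <= K * q ^+ m].
  move=> zd; have [] := geo (cabs z); first by rewrite cabs_ge0.
  move=> K [q [q01 h1 h2]]; exists K, q; split=> [//|m|N m]; rewrite cabsM cabsX //.
have af : sum_on_disc a f.
  move=> z /geoz[K [q [q01 h1 _]]]; have [l hl] := geo_cvg q01 h1.
  by have /cvgP := hl.
exists f; last exact: af.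
split; first exact: (sum_on_disc_holo af).
exists C => _ [z zd <-]; apply/ler_addgt0Pr => e e0.
have [K [q [q01 h1 h2]]] := geoz z zd.
have vz : 0 < v (cabs z) by apply: v0; rewrite cabs_ge0.
have [N hN] := geo_small (v (cabs z) * (2 * K / (1 - q))) q01 e0.
(* The first [N] coefficients agree, so only two geometric tails remain, one of f and one of
   [F N]. *)
have tN : cabs (f z - (F N).[z]) <= 2 * K / (1 - q) * q ^+ N.
  pose M := maxn N (size (F N)).
  have -> : f z - (F N).[z] = (f z - \sum_(m < N) a m * z ^+ m) -
      \sum_(N <= m < M) (F N)`_m * z ^+ m.
    rewrite (horner_coef_wide _ (leq_maxr N _)) -/M.
    rewrite -(big_mkord xpredT (fun m => (F N)`_m * z ^+ m)).
    rewrite (big_cat_nat (leq0n N) (leq_maxl _ _)) /= big_mkord.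
    under [X in _ - (X + _)]eq_bigr => m _ do rewrite Fa //.
    by rewrite opprD addrA.
  rewrite (le_trans (cabsD _ _)) // cabsN.
  rewrite [leRHS](_ : _ = K * (q ^+ N / (1 - q)) + K * (q ^+ N / (1 - q))); last first.
    by ring.
  rewrite lerD //; first exact: geo_tail q01 h1 (af z zd).
  rewrite (le_trans (cabs_sum _ _ _)) //.
  rewrite (@le_trans _ _ (\sum_(N <= m < M) K * q ^+ m)) ?ler_sum //.
  rewrite -mulr_sumr ler_wpM2l ?geo_partial_le //.
  by have := le_trans (cabs_ge0 _) (h1 0%N); rewrite expr0 mulr1.
rewrite (le_trans (ler_wpM2l (ltW vz) (cabs_dist _ (F N).[z]))) // mulrDr lerD ?Fb //.
by rewrite (le_trans (ler_wpM2l (ltW vz) tN)) // mulrA ltW.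
Qed.

End NormalFamily.

(** * Localization of r^m v(r) near the n-th block *)

Section WeightGrowth.
Variable R : realType.
Implicit Types (x y r : R) (n : nat).

(** Since (x - 1)^4 / (x^2 - 1) >= (x - 2)^2, the left side is at most (x - y)(y - x + 2)(x + y)(x +
    y - 2) / y^2. This is bounded for x - 2 < y and decays quadratically in x - y below. *)
Lemma growth_low x y : 2 <= x -> 1 <= y -> y <= x ->
  - y ^+ 2 + x ^+ 2 + (x - 1) ^+ 4 * ((y ^+ 2 - x ^+ 2) / (y ^+ 2 * (x ^+ 2 - 1)))
  <= 6000 - `|y - x|.
Proof.
move=> x2 y1 yx; rewrite distrC ger0_norm ?subr_ge0 //.
have y0 : 0 < y by lra.
have y20 : 0 < y ^+ 2 by rewrite exprn_gt0.
have x10 : 0 < x ^+ 2 - 1 by nra.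
have K : (x - 2) ^+ 2 <= (x - 1) ^+ 4 / (x ^+ 2 - 1).
  rewrite ler_pdivlMr //.
  have -> : (x - 1) ^+ 4 = (x - 1) ^+ 3 * (x - 1) by ring.
  have -> : x ^+ 2 - 1 = (x + 1) * (x - 1) by ring.
  rewrite mulrA; apply: ler_wpM2r; first by lra.
  by rewrite -subr_ge0 [X in 0 <= X](_ : _ = 3 * x - 5); [lra|ring].
have d0 : 0 <= x ^+ 2 - y ^+ 2 by nra.
apply: (@le_trans _ _ ((x ^+ 2 - y ^+ 2) * (y ^+ 2 - (x - 2) ^+ 2) / y ^+ 2)).
  rewrite [leLHS](_ : _ = (x ^+ 2 - y ^+ 2) *
      (y ^+ 2 - (x - 1) ^+ 4 / (x ^+ 2 - 1)) / y ^+ 2); last first.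
    by field; rewrite !gt_eqF.
  by rewrite ler_wpM2r ?invr_ge0 ?(ltW y20) // ler_wpM2l // lerD2l lerN2.
rewrite ler_pdivrMr //.
have -> : x ^+ 2 - y ^+ 2 = (x - y) * (x + y) by ring.
have -> : y ^+ 2 - (x - 2) ^+ 2 = (y - x + 2) * (y + x - 2) by ring.
have [h|h] := leP y (x - 2).
  have h1 : y ^+ 2 <= (x + y) * (y + x - 2) by nra.
  have h2 : 0 <= (x - y) * (x - 2 - y) by apply: mulr_ge0; lra.
  have h3 : (x - y) * (x - 2 - y) * y ^+ 2 <= (x - y) * (x - 2 - y) * ((x + y) * (y + x - 2)).
    by rewrite ler_wpM2l.
  have h4 : - ((x - y) * (x - 2 - y)) * y ^+ 2 <= (6000 - (x - y)) * y ^+ 2.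
    by rewrite ler_wpM2r ?(ltW y20) //; nra.
  by lra.
have h1 : (x + y) * (y + x - 2) <= 8 * y ^+ 2 by nra.
have h2 : 0 <= (x - y) * (y - x + 2) <= 4 by nra.
have h3 : 0 <= (x + y) * (y + x - 2) by apply: mulr_ge0; lra.
have h4 : ((x - y) * (y - x + 2)) * ((x + y) * (y + x - 2)) <= 4 * (8 * y ^+ 2).
  by apply: ler_pM => //; lra.
have h5 : 32 * y ^+ 2 <= (6000 - (x - y)) * y ^+ 2 by rewrite ler_wpM2r ?(ltW y20) //; lra.
by lra.
Qed.

(** As in [growth_low], with (x + 3)^4 / (x^2 - 1) <= (x + 13)^2. For y < x + 13 the quotient is at
    most 169 * 30 = 5070, and 6000 leaves room for the distance. *)
Lemma growth_high x y : 2 <= x -> x <= y ->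
  - y ^+ 2 + x ^+ 2 + (x + 3) ^+ 4 * ((y ^+ 2 - x ^+ 2) / (y ^+ 2 * (x ^+ 2 - 1)))
  <= 6000 - `|y - x|.
Proof.
move=> x2 xy; rewrite ger0_norm ?subr_ge0 //.
have y0 : 0 < y by lra.
have y20 : 0 < y ^+ 2 by rewrite exprn_gt0.
have x10 : 0 < x ^+ 2 - 1 by nra.
have K : (x + 3) ^+ 4 / (x ^+ 2 - 1) <= (x + 13) ^+ 2.
  rewrite ler_pdivrMr // -subr_ge0.
  (* Expanded at x = 2, the polynomial has only positive coefficients. *)
  rewrite [X in 0 <= X](_ : _ = 14 * (x - 2) ^+ 3 + 198 * (x - 2) ^+ 2 + 490 * (x - 2) + 50).
    have t0 : 0 <= x - 2 by rewrite subr_ge0.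
    by rewrite !addr_ge0 ?mulr_ge0 ?exprn_ge0 ?ler0n.
  by ring.
have d0 : 0 <= y ^+ 2 - x ^+ 2 by nra.
apply: (@le_trans _ _ ((y ^+ 2 - x ^+ 2) * ((x + 13) ^+ 2 - y ^+ 2) / y ^+ 2)).
  rewrite [leLHS](_ : _ = (y ^+ 2 - x ^+ 2) *
      ((x + 3) ^+ 4 / (x ^+ 2 - 1) - y ^+ 2) / y ^+ 2); last first.
    by field; rewrite !gt_eqF.
  by rewrite ler_wpM2r ?invr_ge0 ?(ltW y20) // ler_wpM2l // lerD2r.
rewrite ler_pdivrMr //.
have -> : y ^+ 2 - x ^+ 2 = (y - x) * (x + y) by ring.
have -> : (x + 13) ^+ 2 - y ^+ 2 = (x + 13 - y) * (x + 13 + y) by ring.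
have [h|h] := leP (x + 13) y.
  have h1 : y ^+ 2 <= (x + y) * (x + 13 + y) by nra.
  have h2 : 0 <= (y - x) * (y - x - 13) by apply: mulr_ge0; lra.
  have h3 : (y - x) * (y - x - 13) * y ^+ 2 <= (y - x) * (y - x - 13) * ((x + y) * (x + 13 + y)).
    by rewrite ler_wpM2l.
  have h4 : - ((y - x) * (y - x - 13)) * y ^+ 2 <= (6000 - (y - x)) * y ^+ 2.
    by rewrite ler_wpM2r ?(ltW y20) //; nra.
  by lra.
have h1 : (x + y) * (x + 13 + y) <= 30 * y ^+ 2 by nra.
have h2 : 0 <= (y - x) * (x + 13 - y) <= 169 by nra.
have h3 : 0 <= (x + y) * (x + 13 + y) by apply: mulr_ge0; lra.
have h4 : ((y - x) * (x + 13 - y)) * ((x + y) * (x + 13 + y)) <= 169 * (30 * y ^+ 2).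
  by apply: ler_pM => //; lra.
have h5 : 5070 * y ^+ 2 <= (6000 - (y - x)) * y ^+ 2 by rewrite ler_wpM2r ?(ltW y20) //; lra.
by lra.
Qed.

Definition block_radius n : R := 1 - 1 / n%:R ^+ 2.

Lemma block_radius_gt0 n : (2 <= n)%N -> 0 < block_radius n.
Proof.
move=> n2; rewrite subr_gt0 ltr_pdivrMr ?mul1r.
  by rewrite -natrX (ltr_nat _ 1) (@leq_trans (2 ^ 2)) // leq_exp2r.
by rewrite exprn_gt0 // ltr0n (leq_trans _ n2).
Qed.

Lemma block_radius_lt1 n : (2 <= n)%N -> block_radius n < 1.
Proof.
by move=> n2; rewrite gtrBl divr_gt0 // exprn_gt0 // ltr0n (leq_trans _ n2).
Qed.

Lemma weight_block_radius n : (2 <= n)%N -> weight (block_radius n) = expR (- n%:R ^+ 2).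
Proof.
move=> n2; rewrite /weight /block_radius; congr expR.
by rewrite opprB addrCA subrr addr0 !mul1r invrK.
Qed.

Lemma weight_gt0 r : 0 < weight r.
Proof. exact: expR_gt0. Qed.

(* In the variable y = (1 - r)^(-1/2) the functions r^m v(r), with m in the n-th
   block, are Gaussian bumps of bounded width around y = n. *)
Lemma weight_growth n r : (2 <= n)%N -> 0 <= r < 1 ->
  let y := Num.sqrt (1 / (1 - r)) in let rho := r / block_radius n in
  (rho <= 1 -> weight r * expR (n%:R ^+ 2) * rho ^+ (n.-1 ^ 4) <= expR (6000 - `|y - n%:R|)) /\
  (1 <= rho -> weight r * expR (n%:R ^+ 2) * rho ^+ ((n + 3) ^ 4) <= expR (6000 - `|y - n%:R|)).
Proof.
move=> n2 /andP[r0 r1] y rho.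
have r10 : 0 < 1 - r by lra.
have y2 : y ^+ 2 = 1 / (1 - r) by rewrite sqr_sqrtr // divr_ge0 // ltW.
have y0 : 0 <= y by exact: sqrtr_ge0.
have y1 : 1 <= y.
  rewrite -(@ler_pXn2r _ 2) ?nnegrE // expr1n y2 ler_pdivlMr //; lra.
have x2 : 2 <= n%:R :> R by rewrite (ler_nat _ 2).
set x := n%:R in x2 *.
have x0 : 0 < x by lra.
have y00 : 0 < y by lra.
have x10 : 0 < x ^+ 2 - 1 by nra.
have rE : r = 1 - 1 / y ^+ 2 by rewrite y2; field; rewrite gt_eqF.
have y20 : 0 < y ^+ 2 by rewrite exprn_gt0 //; lra.
have x20 : 0 < x ^+ 2 by rewrite exprn_gt0 //; lra.
have radE : block_radius n = (x ^+ 2 - 1) / x ^+ 2 by rewrite /block_radius -/x; field; rewrite gt_eqF.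
have rhoE : rho = 1 + (y ^+ 2 - x ^+ 2) / (y ^+ 2 * (x ^+ 2 - 1)).
  by rewrite /rho radE rE; field; rewrite !gt_eqF.
set t := (y ^+ 2 - x ^+ 2) / _ in rhoE.
have rho0 : 0 <= rho by rewrite divr_ge0 // ltW // block_radius_gt0.
(* Writing [rho] = 1 + t and using 1 + t <= e^t moves the power into the exponent, where
   [growth_low] and [growth_high] apply. *)
have rhoX k : weight r * expR (x ^+ 2) * rho ^+ k <= expR (- y ^+ 2 + x ^+ 2 + k%:R * t).
  rewrite !expRD /weight -y2 ler_wpM2l ?mulr_ge0 ?expR_ge0 //.
  rewrite expRM_natl lerXn2r ?nnegrE ?expR_ge0 // rhoE; exact: expR_ge1Dx.
have den0 : 0 < y ^+ 2 * (x ^+ 2 - 1) by rewrite mulr_gt0.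
split=> rho1; apply: (le_trans (rhoX _)); rewrite ler_expR natrX.
- have -> : n.-1%:R = x - 1 by rewrite -subn1 natrB // (leq_trans _ n2).
  apply: growth_low => //.
  rewrite rhoE gerDl pmulr_lle0 ?invr_gt0 // subr_le0 in rho1.
  by rewrite -(@ler_pXn2r _ 2) ?nnegrE //; lra.
- rewrite natrD; apply: growth_high => //.
  rewrite rhoE lerDl pmulr_lge0 ?invr_gt0 // subr_ge0 in rho1.
  by rewrite -(@ler_pXn2r _ 2) ?nnegrE //; lra.
Qed.

(* exp (-|y - n|) is dominated by an increment of the logistic function. *)
Lemma sum_exp_dist y (a b : nat) : \sum_(a <= n < b) expR (- `|y - n%:R|) <= 8.
Proof.
pose E n : R := expR (y - n%:R); pose g n : R := (1 + E n)^-1.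
have E0 n : 0 < E n by exact: expR_gt0.
have g01 n : 0 <= g n <= 1.
  rewrite invr_ge0 invf_le1 ?addr_gt0 // lerDl (ltW (E0 n)) andbT.
  by rewrite addr_ge0 // ltW.
(* From e >= 2 follows E(n+1) <= E(n) / 2, so the increment of g is at least half of E(n) / (1 +
   E(n))^2 up to the smaller factor 1 + E(n+1); and e^(-|u|) (1 + e^u)^2 <= 4 e^u. *)
have step n : expR (- `|y - n%:R|) <= 8 * (g n.+1 - g n).
  have ES : E n.+1 <= E n / 2.
    have -> : E n.+1 = E n * expR (-1) by rewrite /E -expRD -natr1 opprD addrA.
    rewrite ler_wpM2l ?expR_ge0 // expRN lef_pV2 ?posrE ?expR_gt0 //.
    by have := expR_ge1Dx (1 : R); lra.
  have E1 := E0 n; have E2 := E0 n.+1.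
  have -> : g n.+1 - g n = (E n - E n.+1) / ((1 + E n) * (1 + E n.+1)).
    by rewrite /g; field; rewrite !gt_eqF ?addr_gt0.
  rewrite mulrA ler_pdivlMr ?mulr_gt0 ?addr_gt0 //.
  have h : expR (- `|y - n%:R|) * (1 + E n) ^+ 2 <= 4 * E n.
    have [yn|ny] := leP 0 (y - n%:R).
      have e1 : 1 <= E n by rewrite -expR0 ler_expR.
      rewrite ger0_norm // expRN -/(E n) ler_pdivrMl //; nra.
    have e1 : E n <= 1 by rewrite -expR0 ler_expR ltW.
    rewrite ltr0_norm // opprK -/(E n); nra.
  have h' : expR (- `|y - n%:R|) * ((1 + E n) * (1 + E n.+1)) <=
            expR (- `|y - n%:R|) * (1 + E n) ^+ 2.
    rewrite ler_wpM2l ?expR_ge0 // expr2 ler_wpM2l ?addr_ge0 ?(ltW E1) //; lra.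
  by lra.
have [ab|/ltnW ba] := leqP a b; last by rewrite big_geq.
apply: (@le_trans _ _ (\sum_(a <= n < b) 8 * (g n.+1 - g n))); first exact: ler_sum.
rewrite -mulr_sumr telescope_sumr //.
by have := g01 a; have := g01 b; lra.
Qed.

End WeightGrowth.

(** * Gluing block polynomials into a function of the weighted space *)

Section Blocks.
Variable R : realType.
Implicit Types (P : {poly R[i]}) (n m : nat) (K : R).

(* The exponent (n + 3)^4 exceeds the degree bound (n + 2)^4: the estimate of
   [vallee_poussin] outside the unit disc is not sharp. *)
Definition block_poly K n P :=
  [/\ forall m, (m <= n.-1 ^ 4)%N -> P`_m = 0,
      forall m, ((n + 2) ^ 4 < m)%N -> P`_m = 0,
      forall z, cabs z <= 1 -> cabs P.[z] <= K * cabs z ^+ (n.-1 ^ 4) &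
      forall z, 1 <= cabs z -> cabs P.[z] <= K * cabs z ^+ ((n + 3) ^ 4)].

Lemma coef_comp_scaleX P (c : R[i]) m : (P \Po (c *: 'X))`_m = c ^+ m * P`_m.
Proof.
rewrite comp_polyE coef_sum.
under eq_bigr do rewrite exprZn scalerA coefZ coefXn.
have [mP|Pm] := ltnP m (size P).
  rewrite (bigD1 (Ordinal mP)) //= eqxx mulr1 big1 ?addr0 ?[_ * c ^+ m]mulrC // => i im.
  by rewrite -val_eqE eq_sym in im; rewrite (negbTE im) mulr0.
rewrite nth_default // mulr0 big1 // => i _.
by rewrite gtn_eqF ?mulr0 // (leq_trans (ltn_ord i)).
Qed.

(** The dilation by the inverse block radius turns |z| into [rho] of [weight_growth]; the low
    frequency bound serves for [rho] <= 1 and the high one for [rho] >= 1. *)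
Lemma weight_block_poly K n P z : (2 <= n)%N -> 0 <= K -> block_poly K n P -> disc z ->
  weight (cabs z) * (expR (n%:R ^+ 2) * cabs P.[(block_radius R n)^-1%:C * z]) <=
  K * (expR 6000 * expR (- `|Num.sqrt (1 / (1 - cabs z)) - n%:R|)).
Proof.
move=> n2 K0 [_ _ Plow Phigh] zd; rewrite /disc in zd.
have z01 : 0 <= cabs z < 1 by rewrite cabs_ge0.
have [low high] := weight_growth n2 z01.
set rho := cabs z / block_radius R n in low high.
have wE : cabs ((block_radius R n)^-1%:C * z) = rho.
  by rewrite cabsM cabs_real gtr0_norm ?invr_gt0 ?block_radius_gt0 // mulrC.
rewrite -expRD mulrA.
have key (b : R) : cabs P.[(block_radius R n)^-1%:C * z] <= K * b ->
    weight (cabs z) * expR (n%:R ^+ 2) * b <=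
    expR (6000 - `|Num.sqrt (1 / (1 - cabs z)) - n%:R|) ->
    weight (cabs z) * expR (n%:R ^+ 2) * cabs P.[(block_radius R n)^-1%:C * z] <=
    K * expR (6000 - `|Num.sqrt (1 / (1 - cabs z)) - n%:R|).
  move=> h1 h2; apply: le_trans (ler_wpM2l K0 h2).
  rewrite mulrCA ler_wpM2l // mulr_ge0 ?expR_ge0 //.
have [r1|/ltW r1] := leP rho 1.
  by apply: key (low r1); rewrite -wE; apply: Plow; rewrite wE.
by apply: key (high r1); rewrite -wE; apply: Phigh; rewrite wE.
Qed.

(** The dilated polynomials of one parity are added. Their sum is bounded by [sum_exp_dist], and two
    indices of equal parity differ by at least 2, so no other spectrum meets the n-th block. *)
Lemma blocks_taylor_coefs K (P : nat -> {poly R[i]}) (e : bool) :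
  (forall n, (2 <= n)%N -> block_poly K n (P n)) ->
  exists2 a, taylor_coefs (Hinfty (@weight R)) a &
    forall n m, (2 <= n)%N -> odd n = e -> (n ^ 4 < m <= n.+1 ^ 4)%N ->
      a m = (expR (n%:R ^+ 2) * block_radius R n ^- m)%:C * (P n)`_m.
Proof.
move=> PK.
have K0 : 0 <= K.
  have [_ _ h _] := PK 2 isT; have := h 1; rewrite cabs1 expr1n mulr1 lexx => /(_ isT).
  exact: le_trans (cabs_ge0 _).
pose Q n : {poly R[i]} := if odd n == e then
  (expR (n%:R ^+ 2))%:C *: (P n \Po ((block_radius R n)^-1%:C *: 'X)) else 0.
have QE n m : odd n = e -> (Q n)`_m = (expR (n%:R ^+ 2) * block_radius R n ^- m)%:C * (P n)`_m.
  move=> ne; rewrite /Q ne eqxx coefZ coef_comp_scaleX mulrA rmorphM /=.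
  by rewrite -exprVn rmorphXn.
have Q0 n m : (odd n = e -> (P n)`_m = 0) -> (Q n)`_m = 0.
  have [ne|ne] := eqVneq (odd n) e; first by move=> /(_ ne) h; rewrite QE // h mulr0.
  by rewrite /Q (negbTE ne) coef0.
have leX4 i j : (i <= j)%N -> (i ^ 4 <= j ^ 4)%N by move=> ij; rewrite leq_exp2r.
have leX1 i : (i <= i ^ 4)%N by case: i => // i; rewrite -{1}[i.+1]expn1 leq_pexp2l.
pose F N := \sum_(2 <= n < N.+2) Q n.
(* The m-th coefficient is stable from here on: for k >= m + 3 the spectrum of [P k] starts above (k
   - 1)^4 >= m. *)
pose a m := (F m.+1)`_m.
exists a; last first.
  move=> n m n2 ne /andP[nm mn]; rewrite /a /F coef_sum.
  have n3 : (n < m.+3)%N by have := leX1 n; lia.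
  rewrite (bigD1_seq n) ?mem_index_iota ?n2 ?n3 ?iota_uniq //= QE //.
  rewrite big_seq_cond big1 ?addr0 // => k /andP[]; rewrite mem_index_iota.
  move=> /andP[k2 km] kn; apply: Q0 => ke.
  have [h1 h2 _ _] := PK k k2.
  have [/h1 //|lk] := leqP m (k.-1 ^ 4)%N; apply: h2.
  have : (k < n)%N.
    rewrite ltn_neqAle kn leqNgt; apply/negP => nk.
    have : (n.+1 ^ 4 <= k.-1 ^ 4)%N; last by lia.
    apply: leX4; suff : k <> n.+1 by lia.
    by move=> kE; move: ke; rewrite kE /= ne; case: (e).
  move=> kn'; have : ((k + 2) ^ 4 <= n ^ 4)%N; last by lia.
  apply: leX4; suff : n <> k.+1 by lia.
  by move=> kE; move: ne; rewrite kE /= ke; case: (e).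
apply: (@taylor_coefs_Hinfty_lim _ _ F (K * (expR 6000 * 8))).
- by move=> r _; exact: weight_gt0.
- move=> N z zd; rewrite horner_sum.
  rewrite (le_trans (ler_wpM2l (ltW (weight_gt0 _)) (cabs_sum _ _ _))) // mulr_sumr.
  pose y := Num.sqrt (1 / (1 - cabs z)).
  apply: (@le_trans _ _ (\sum_(2 <= n < N.+2) K * (expR 6000 * expR (- `|y - n%:R|)))).
    rewrite big_seq_cond [leRHS]big_seq_cond; apply: ler_sum => n.
    rewrite mem_index_iota => /andP[/andP[n2 _] _].
    rewrite /Q; case: ifP => ne; last first.
      by rewrite horner0 cabs0 mulr0 !mulr_ge0 ?expR_ge0.
    rewrite hornerZ horner_comp hornerZ hornerX cabsM cabs_real ger0_norm ?expR_ge0 //.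
    by apply: weight_block_poly => //; exact: PK.
  by rewrite -mulr_sumr ler_wpM2l // -mulr_sumr ler_wpM2l ?expR_ge0 // sum_exp_dist.
- move=> N m mN; rewrite /a /F.
  rewrite (@big_cat_nat _ _ _ m.+3) ?ltnS //= coefD addrC coef_sum.
  rewrite big_seq_cond big1 ?add0r // => k; rewrite mem_index_iota.
  move=> /andP[/andP[k2 km] _]; apply: Q0 => ke.
  have [h1 _ _ _] := PK k (leq_trans (isT : (2 <= m.+3)%N) k2); apply: h1.
  by have := leX1 k.-1; lia.
Qed.

End Blocks.

(** * Smooth truncation of complex values *)

Section SoftClip.
Variable R : realType.
Implicit Types (u w : R[i]).

(* A bounded function that differs from the identity by O(|w|^3) near 0. *)
Definition soft_clip w : R[i] := (6 / (6 + cabs w ^+ 2))%:C * w.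

Lemma soft_clip_le2 w : cabs (soft_clip w) <= 2.
Proof.
have t0 := cabs_ge0 w; have t2 : 0 <= cabs w ^+ 2 by exact: sqr_ge0.
have p0 : 0 < 6 + cabs w ^+ 2 by lra.
rewrite cabsM cabs_real ger0_norm ?divr_ge0 ?(ltW p0) //.
by rewrite mulrAC ler_pdivrMr //; nra.
Qed.

(** The truncation error is T(|w|^2) w with T(s) = s / (6 + s), which is at most s / 6 and
    1/6-Lipschitz for s >= 0; the mixed term |u| |w| is at most (|u|^2 + |w|^2) / 2. *)
Lemma soft_clip_lip u w :
  cabs ((u - soft_clip u) - (w - soft_clip w)) <=
  cabs (u - w) * ((cabs u ^+ 2 + cabs w ^+ 2) / 4).
Proof.
pose T (s : R) := s / (6 + s).
have hE z : z - soft_clip z = (T (cabs z ^+ 2))%:C * z.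
  rewrite /soft_clip -{1}[z]mul1r -mulrBl -(rmorph1 (real_complex R)) -rmorphB /=.
  congr (_%:C * _); rewrite /T; field.
  by rewrite gt_eqF // ltr_pwDl // sqr_ge0.
rewrite !hE; set s := cabs u ^+ 2; set t := cabs w ^+ 2.
have s0 : 0 <= s by exact: sqr_ge0.
have t0 : 0 <= t by exact: sqr_ge0.
have s6 : 0 < 6 + s by lra.
have t6 : 0 < 6 + t by lra.
have -> : (T s)%:C * u - (T t)%:C * w = (T s)%:C * (u - w) + (T s - T t)%:C * w.
  by rewrite rmorphB /=; ring.
rewrite (le_trans (cabsD _ _)) // !cabsM !cabs_real.
have Ts : `|T s| <= s / 6.
  rewrite ger0_norm; last by rewrite divr_ge0 // ltW.
  by rewrite ler_wpM2l // lef_pV2 ?posrE //; lra.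
have uw0 := cabs_ge0 (u - w); have u0 := cabs_ge0 u; have w0 := cabs_ge0 w.
have st : `|s - t| <= cabs (u - w) * (cabs u + cabs w).
  have -> : s - t = (cabs u - cabs w) * (cabs u + cabs w) by rewrite /s /t; ring.
  rewrite normrM (ger0_norm (addr_ge0 u0 w0)) ler_wpM2r ?addr_ge0 // ler_norml.
  have := cabs_dist u w; have := cabs_dist w u; rewrite (cabsB w u); lra.
have Tst : `|T s - T t| <= `|s - t| / 6.
  have -> : T s - T t = (s - t) * (6 / ((6 + s) * (6 + t))).
    by rewrite /T; field; rewrite !gt_eqF.
  rewrite normrM ler_wpM2l // ger0_norm; last by rewrite divr_ge0 // mulr_ge0 // ltW.
  by rewrite ler_pdivrMr ?mulr_gt0 //; nra.
apply: (@le_trans _ _ (cabs (u - w) * (s / 6) +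
    cabs (u - w) * (cabs u + cabs w) / 6 * cabs w)).
  apply: lerD; first by rewrite mulrC ler_wpM2l.
  by rewrite ler_wpM2r // (le_trans Tst) // ler_wpM2r.
rewrite -!mulrA -mulrDr ler_wpM2l // /s /t.
by have := sqr_ge0 (cabs u - cabs w); rewrite sqrrB; lra.
Qed.

End SoftClip.

(** * Random signs; expectations are sums over all sign patterns, scaled by [card] *)

Section RandomSigns.
Variables (R : realType) (I : finType).
Implicit Types (e : {ffun I -> bool}) (beta : I -> R[i]) (i j : I).

Definition sgn e i : R[i] := (-1) ^+ e i.
Definition flip i e : {ffun I -> bool} := [ffun j => e j (+) (j == i)].
Definition sign_sum beta e : R[i] := \sum_i sgn e i * beta i.
Local Notation card := (#|{ffun I -> bool}|%:R).

Lemma flipK i : involutive (flip i).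
Proof. by move=> e; apply/ffunP => j; rewrite !ffunE -addbA addbb addbF. Qed.

Lemma sgn_flip e i : sgn (flip i e) i = - sgn e i.
Proof. by rewrite /sgn ffunE eqxx addbT; case: (e i); rewrite /= ?expr0 ?expr1 ?opprK. Qed.

Lemma sgn_flip_neq e i j : j != i -> sgn (flip i e) j = sgn e j.
Proof. by move=> ji; rewrite /sgn ffunE (negbTE ji) addbF. Qed.

Lemma cabs_sgn e i : cabs (sgn e i) = 1.
Proof. by rewrite /sgn cabsX cabsN cabs1 expr1n. Qed.

Lemma sgn_conj e i : (sgn e i)^*%C = sgn e i.
Proof. by rewrite /sgn rmorphXn rmorphN1. Qed.

Lemma sgn_sqr e i : sgn e i * sgn e i = 1.
Proof. by rewrite /sgn -expr2 sqrr_sign. Qed.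

Lemma sign_sum_flip beta e i :
  sign_sum beta e - sign_sum beta (flip i e) = 2 * (sgn e i * beta i).
Proof.
rewrite /sign_sum (bigD1 i) //= [X in _ - X](bigD1 i) //= sgn_flip.
rewrite [X in _ - (_ + X)](eq_bigr (fun j => sgn e j * beta j)); first by ring.
by move=> j ji; rewrite sgn_flip_neq.
Qed.

(** For i != j, flipping the i-th sign is a bijection that negates the sum. *)
Lemma sgn_orthogonal i j : \sum_e sgn e i * sgn e j = (i == j)%:R * card.
Proof.
have [->|ij] := eqVneq i j.
  by under eq_bigr do rewrite sgn_sqr; rewrite sumr_const mul1r cardT -cardE.
rewrite mul0r; set S := LHS.
have SN : S = - S.
  rewrite {1}/S (reindex_inj (inv_inj (flipK i))) /= -sumrN.
  by apply: eq_bigr => e _; rewrite sgn_flip (sgn_flip_neq e (i := i)) 1?eq_sym // mulNr.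
have /eqP : S *+ 2 = 0 by rewrite mulr2n {1}SN addNr.
by rewrite mulrn_eq0 => /eqP.
Qed.

Lemma sign_sum_mean beta i : \sum_e sgn e i * sign_sum beta e = card * beta i.
Proof.
under eq_bigr do rewrite mulr_sumr.
rewrite exchange_big /= (bigD1 i) //= [X in _ + X]big1 ?addr0 => [|j ji].
  by under eq_bigr do rewrite mulrA; rewrite -mulr_suml sgn_orthogonal eqxx mul1r.
under eq_bigr do rewrite mulrA.
by rewrite -mulr_suml sgn_orthogonal eq_sym (negbTE ji) !mul0r.
Qed.

Lemma sign_sum_sqr beta :
  \sum_e cabs (sign_sum beta e) ^+ 2 = card * \sum_i cabs (beta i) ^+ 2.
Proof.
apply: complexI; rewrite rmorph_sum rmorphM rmorph_sum /= rmorph_nat.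
transitivity (\sum_e \sum_i \sum_j (sgn e i * sgn e j) * (beta i * (beta j)^*%C)).
  apply: eq_bigr => e _; rewrite sqr_cabs /sign_sum rmorph_sum /= big_distrlr /=.
  apply: eq_bigr => i _; apply: eq_bigr => j _.
  by rewrite rmorphM /= sgn_conj mulrACA.
rewrite exchange_big mulr_sumr /=; apply: eq_bigr => i _.
rewrite exchange_big (bigD1 i) //= [X in _ + X]big1 ?addr0 => [|j ji].
  by rewrite -mulr_suml sgn_orthogonal eqxx mul1r sqr_cabs.
by rewrite -mulr_suml sgn_orthogonal eq_sym (negbTE ji) !mul0r.
Qed.

(* Flipping the i-th sign changes [sign_sum] by 2 beta_i only, so the weak Lipschitz bound
   [soft_clip_lip] controls the contribution of the truncation error, on average. *)
Lemma clip_mean beta i : \sum_j cabs (beta j) ^+ 2 <= 1 ->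
  cabs (\sum_e sgn e i * soft_clip (sign_sum beta e) - card * beta i) <=
  card * (cabs (beta i) / 2).
Proof.
move=> b1; rewrite -sign_sum_mean -sumrB.
pose f e := sign_sum beta e.
pose S := \sum_e sgn e i * (f e - soft_clip (f e)).
have -> : \sum_e (sgn e i * soft_clip (sign_sum beta e) - sgn e i * sign_sum beta e) = - S.
  by rewrite /S -sumrN; apply: eq_bigr => e _; rewrite /f; ring.
(* Pairing each pattern with its flip produces the differences to which [soft_clip_lip] applies. *)
have SE : 2 * S = \sum_e sgn e i *
    ((f e - soft_clip (f e)) - (f (flip i e) - soft_clip (f (flip i e)))).
  rewrite mulr_natl mulr2n {2}/S (reindex_inj (inv_inj (flipK i))) /= -big_split /=.
  by apply: eq_bigr => e _; rewrite sgn_flip; ring.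
have : cabs (2 * S) <= card * cabs (beta i).
  rewrite SE (le_trans (cabs_sum _ _ _)) //.
  apply: (@le_trans _ _ (\sum_e (cabs (beta i) / 2) *
      (cabs (f e) ^+ 2 + cabs (f (flip i e)) ^+ 2))).
    apply: ler_sum => e _; rewrite cabsM cabs_sgn mul1r.
    rewrite (le_trans (soft_clip_lip _ _)) // /f sign_sum_flip !cabsM cabs_sgn mul1r.
    rewrite (cabs_nat R 2) le_eqVlt; apply/orP; left; apply/eqP.
    by field.
  rewrite -mulr_sumr big_split /=.
  have <- : \sum_e cabs (f e) ^+ 2 = \sum_e cabs (f (flip i e)) ^+ 2.
    by rewrite (reindex_inj (inv_inj (flipK i))).
  rewrite sign_sum_sqr -mulr2n -[_ *+ 2]mulr_natr.
  rewrite [leLHS](_ : _ = card * cabs (beta i) * \sum_j cabs (beta j) ^+ 2); last by field.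
  by rewrite ler_piMr // mulr_ge0 ?cabs_ge0.
by rewrite cabsN cabsM (cabs_nat R 2); lra.
Qed.

End RandomSigns.

(** * A de la Vallee-Poussin kernel on roots of unity *)

Section ValleePoussin.
Variable R : realType.
Implicit Types (z w : R[i]) (s A B N : nat).

Definition geo_poly A : {poly R[i]} := \poly_(i < A) 1.

(** On this range every i < A has its partner m - i in [0, B), so the convolution counts all A
    indices. *)
Lemma coef_geo_polyM A B m : (A <= B)%N -> (A.-1 <= m < B)%N ->
  (geo_poly A * geo_poly B)`_m = A%:R.
Proof.
move=> AB /andP[Am mB]; rewrite coefM.
have [->|A0] := posnP A; first by rewrite big1 // => i _; rewrite coef_poly mul0r.
rewrite (eq_bigr (fun i : 'I_m.+1 => (nat_of_bool (i < A)%N)%:R)); last first.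
  move=> i _; rewrite !coef_poly; have -> : (m - i < B)%N by lia.
  by rewrite mulr1; case: ifP.
rewrite -(big_mkord xpredT (fun i => (nat_of_bool (i < A)%N)%:R)).
rewrite (@big_cat_nat _ _ _ A) //=; last by lia.
rewrite [X in _ + X]big_nat_cond [X in _ + X]big1 ?addr0; last first.
  by move=> i /andP[/andP[Ai _] _]; rewrite ltnNge Ai.
rewrite big_nat_cond (eq_bigr (fun=> 1)).
  by rewrite -big_nat_cond sumr_const_nat subn0.
by move=> i /andP[/andP[_ ->] _].
Qed.

Lemma geo_poly_sum_le N w A z (mu : R) : N.-primitive_root w -> (A <= N)%N ->
  (forall k, (k < A)%N -> cabs z ^+ k <= mu) ->
  \sum_(j < N) cabs (geo_poly A).[z * w ^+ j] ^+ 2 <= N%:R * (A%:R * mu ^+ 2).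
Proof.
move=> wp AN zmu; rewrite (parseval z wp); last by rewrite (leq_trans (size_poly _ _)).
rewrite ler_wpM2l // -(big_mkord xpredT (fun m => (cabs (geo_poly A)`_m * cabs z ^+ m) ^+ 2)).
rewrite (big_cat_nat (leq0n A) AN) /= [X in _ + X]big_nat_cond [X in _ + X]big1 ?addr0.
  rewrite big_mkord (le_trans (ler_sum (G := fun=> mu ^+ 2) _ _)) //.
    move=> i _; rewrite coef_poly ltn_ord cabs1 mul1r.
    have z0 : 0 <= cabs z ^+ i by rewrite exprn_ge0 ?cabs_ge0.
    by rewrite lerXn2r ?nnegrE // ?zmu // (le_trans z0) // zmu.
  by rewrite sumr_const card_ord mulr_natl.
move=> i /andP[/andP[Ai _] _].
have -> : (geo_poly A)`_i = 0 by rewrite coef_poly ltnNge Ai.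
by rewrite cabs0 mul0r expr0n.
Qed.

(* The kernel is X^s times the product of two geometric sums of lengths A and B, divided by
   A: its coefficients are 1 on a plateau of length B - A + 1, and its l^1-mean on circles
   is controlled by Parseval applied to the two factors. *)
Lemma vallee_poussin N w s A B (F : 'I_N -> R[i]) :
  N.-primitive_root w -> (0 < A)%N -> (A <= B)%N -> (B <= N)%N ->
  (forall j, cabs (F j) <= 2) ->
  exists P : {poly R[i]}, [/\ forall m, (m < s)%N -> P`_m = 0,
    forall m, (s + (A + B).-1 <= m)%N -> P`_m = 0,
    forall m, (s + A.-1 <= m < s + B)%N ->
      P`_m = N%:R^-1 * \sum_j F j * w ^+ j ^+ m,
    forall z, cabs z <= 1 -> cabs P.[z] <= (A + B)%:R / A%:R * cabs z ^+ s &
    forall z, 1 <= cabs z -> cabs P.[z] <= (A + B)%:R / A%:R * cabs z ^+ (s + 2 * B)].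
Proof.
move=> wp A0 AB BN F2; have N0 := prim_order_gt0 wp.
have An0 : A%:R != 0 :> R[i] by rewrite pnatr_eq0 -lt0n.
pose ker := 'X^s * (geo_poly A * geo_poly B).
(* [F] is convolved with the kernel, which multiplies its m-th discrete Fourier coefficient by the
   m-th coefficient of [ker] over A. *)
pose P := (A%:R * N%:R)^-1 *: \sum_j F j *: (ker \Po (w ^+ j *: 'X)).
have PE m : P`_m = (A%:R^-1 * ker`_m) * (N%:R^-1 * \sum_j F j * w ^+ j ^+ m).
  rewrite coefZ coef_sum invfM.
  under eq_bigr do rewrite coefZ coef_comp_scaleX mulrA.
  by rewrite -mulr_suml; ring.
(* The bound 2 on [F] is absorbed by 2 x y <= x^2 + y^2. Later [mu] is 1 inside the disc and |z|^B
   outside, whence the exponent s + 2 B. *)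
have PB z (mu : R) : (forall k, (k < B)%N -> cabs z ^+ k <= mu) ->
    cabs P.[z] <= (A + B)%:R / A%:R * (cabs z ^+ s * mu ^+ 2).
  move=> zmu; have AR0 : 0 < A%:R :> R by rewrite ltr0n.
  have NR0 : 0 < N%:R :> R by rewrite ltr0n.
  rewrite hornerZ horner_sum cabsM cabsV cabsM !cabs_nat.
  rewrite ler_pdivrMl ?mulr_gt0 // (le_trans (cabs_sum _ _ _)) //.
  apply: (@le_trans _ _ (\sum_(j < N) cabs z ^+ s * (cabs (geo_poly A).[z * w ^+ j] ^+ 2 +
      cabs (geo_poly B).[z * w ^+ j] ^+ 2))).
    apply: ler_sum => j _; rewrite hornerZ horner_comp hornerZ hornerX /ker !hornerM hornerXn.
    rewrite !cabsM !cabsX cabsM cabsX (cabs_prim_root wp) expr1n mul1r [w ^+ j * z]mulrC.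
    have a0 := cabs_ge0 (geo_poly A).[z * w ^+ j].
    have b0 := cabs_ge0 (geo_poly B).[z * w ^+ j].
    rewrite mulrCA ler_wpM2l ?exprn_ge0 ?cabs_ge0 //.
    apply: (@le_trans _ _ (2 * (cabs (geo_poly A).[z * w ^+ j] *
        cabs (geo_poly B).[z * w ^+ j]))).
      by rewrite ler_wpM2r ?mulr_ge0.
    have := sqr_ge0 (cabs (geo_poly A).[z * w ^+ j] - cabs (geo_poly B).[z * w ^+ j]).
    by rewrite sqrrB; lra.
  rewrite -mulr_sumr big_split /=.
  have hA := geo_poly_sum_le wp (leq_trans AB BN) (fun k kA => zmu k (leq_trans kA AB)).
  have hB := geo_poly_sum_le wp BN zmu.
  apply: (@le_trans _ _ (cabs z ^+ s * (N%:R * (A%:R * mu ^+ 2) + N%:R * (B%:R * mu ^+ 2)))).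
    by rewrite ler_wpM2l ?exprn_ge0 ?cabs_ge0 // lerD.
  by rewrite le_eqVlt; apply/orP; left; apply/eqP; rewrite natrD; field; rewrite gt_eqF.
exists P; split.
- by move=> m ms; rewrite PE /ker coefXnM ms mulr0 mul0r.
- move=> m sm; rewrite PE /ker coefXnM ifF; last by apply/negP; lia.
  rewrite nth_default ?mulr0 ?mul0r //.
  rewrite (leq_trans (size_polyMleq _ _)) //.
  have sA : (size (geo_poly A) <= A)%N := size_poly _ _.
  have sB : (size (geo_poly B) <= B)%N := size_poly _ _.
  by lia.
- move=> m /andP[m1 m2]; rewrite PE /ker coefXnM ifF; last by apply/negP; lia.
  by rewrite coef_geo_polyM // ?mulVf ?mul1r //; lia.
- move=> z z1; have := PB z 1; rewrite expr1n mulr1; apply => k _.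
  by rewrite exprn_ile1 ?cabs_ge0.
- move=> z z1; have := PB z (cabs z ^+ B); rewrite -exprM mulnC -exprD; apply => k kB.
  by rewrite ler_weXn2l // ltnW.
Qed.

End ValleePoussin.

(** * Bounded block polynomials with prescribed mean coefficients *)

Section RandomBlock.
Variable R : realType.

(** Random sums with coefficients +-b_m are truncated at each root of unity. On average each Fourier
    coefficient keeps at least half its size, so some sign pattern does so in the mean with weights
    [d]. *)
Lemma block_poly_random n (b d : nat -> R) : (2 <= n)%N ->
  (forall m, 0 <= b m) -> (forall m, 0 <= d m) ->
  \sum_((n ^ 4).+1 <= m < (n.+1 ^ 4).+1) b m ^+ 2 <= 1 ->
  exists2 P : {poly R[i]}, block_poly 11 n P &
    \sum_((n ^ 4).+1 <= m < (n.+1 ^ 4).+1) d m * (b m / 2) <=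
    \sum_((n ^ 4).+1 <= m < (n.+1 ^ 4).+1) d m * cabs P`_m.
Proof.
move=> n2 b0 d0 b1.
pose a := (n ^ 4).+1; pose L := (n.+1 ^ 4).+1.
(* The choice makes the plateau from s + A - 1 to s + B - 1 equal to the n-th block; the ramps, of
   length about n^3, stay within the spectrum allowed by [block_poly]. *)
pose A := (n ^ 3)%N; pose B := (A + (L - a)).-1; pose s := (a - A.-1)%N.
have n4 : (n ^ 4 = n ^ 3 * n)%N by rewrite expnSr.
have n3 : (n ^ 3 = n ^ 2 * n)%N by rewrite expnSr.
have n22 : (n ^ 2 = n * n)%N by rewrite expnSr expn1.
have LE : (n.+1 ^ 4 = n ^ 4 + 4 * n ^ 3 + 6 * n ^ 2 + 4 * n + 1)%N by lia.
have L2 : ((n + 2) ^ 4 = n ^ 4 + 8 * n ^ 3 + 24 * n ^ 2 + 32 * n + 16)%N by lia.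
have L3 : ((n + 3) ^ 4 = n ^ 4 + 12 * n ^ 3 + 54 * n ^ 2 + 108 * n + 81)%N by lia.
have L1 : (n.-1 ^ 4 + 4 * n ^ 3 + 4 * n = n ^ 4 + 6 * n ^ 2 + 1)%N.
  by move: n2 {L3 L2 LE n22 n3 n4 B s A L a b1}; case: n => // k _ /=; lia.
have i1 : (2 * n <= n ^ 2)%N by rewrite n22 leq_mul2r n2 orbT.
have i2 : (2 * n ^ 2 <= n ^ 3)%N by rewrite n3 mulnC leq_mul2l n2 orbT.
have i3 : (2 * n ^ 3 <= n ^ 4)%N by rewrite n4 mulnC leq_mul2l n2 orbT.
have A0 : (0 < A)%N by rewrite expn_gt0; lia.
have AB : (A <= B)%N by rewrite /B /L /a; lia.
have [w wp] := @exists_prim_root R B (leq_trans A0 AB).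
(* Sampling at inverse roots makes zeta_j^i cancel the factor w^(j i) of the Fourier coefficient. *)
pose zeta (j : 'I_B) : R[i] := (w ^+ j)^-1.
have z1 j : cabs (zeta j) = 1 by rewrite cabsV cabsX (cabs_prim_root wp) expr1n invr1.
pose beta j (i : 'I_L) : R[i] := if (a <= i)%N then (b i)%:C * zeta j ^+ i else 0.
have cbeta j i : cabs (beta j i) = if (a <= i)%N then b i else 0.
  rewrite /beta; case: ifP => _; last exact: cabs0.
  by rewrite cabsM cabsX z1 expr1n mulr1 cabs_real ger0_norm.
have beta1 j : \sum_i cabs (beta j i) ^+ 2 <= 1.
  apply: le_trans b1; rewrite big_geq_mkord /= [leRHS]big_mkcond /=.
  by apply: ler_sum => i _; rewrite cbeta; case: ifP => // _; rewrite expr0n.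
pose F e j := soft_clip (sign_sum (beta j) e).
pose hat e m : R[i] := B%:R^-1 * \sum_j F e j * w ^+ j ^+ m.
pose card : R := #|{ffun 'I_L -> bool}|%:R.
have card0 : 0 < card.
  by rewrite ltr0n; apply/card_gt0P; exists [ffun=> true].
have w0 : w != 0.
  by rewrite -cabs_eq0 (cabs_prim_root wp) oner_eq0.
have B0 : B%:R != 0 :> R by rewrite pnatr_eq0; lia.
have hat_mean (i : 'I_L) : (a <= i)%N -> card * (b i / 2) <= \sum_e cabs (hat e i).
  move=> ai; apply: (@le_trans _ _ (cabs (\sum_e sgn R e i * hat e i))); last first.
    rewrite (le_trans (cabs_sum _ _ _)) //.
    by apply: ler_sum => e _; rewrite cabsM cabs_sgn mul1r.
  have SE : \sum_e sgn R e i * hat e i - (card * b i)%:C = B%:R^-1 * \sum_j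
      (\sum_e sgn R e i * F e j - card%:C * beta j i) * w ^+ j ^+ i.
    have bw j : beta j i * w ^+ j ^+ i = (b i)%:C.
      by rewrite /beta ai /zeta -mulrA -exprMn mulVf ?expf_neq0 // expr1n mulr1.
    under [in RHS]eq_bigr => j _ do rewrite mulrBl -mulrA bw -rmorphM.
    rewrite sumrB mulrBr sumr_const card_ord; congr (_ - _).
      rewrite /hat; under eq_bigr do rewrite mulrCA.
      rewrite -mulr_sumr; congr (_ * _).
      under eq_bigr do rewrite mulr_sumr; rewrite exchange_big /=.
      by apply: eq_bigr => j _; rewrite mulr_suml; apply: eq_bigr => e _; rewrite mulrA.
    by rewrite -[X in _ = _ * X]mulr_natl mulKf // pnatr_eq0; lia.
  have SD : cabs (\sum_e sgn R e i * hat e i - (card * b i)%:C) <= card * (b i / 2).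
    rewrite SE cabsM cabsV cabs_nat ler_pdivrMl; last by rewrite lt_def B0 /=.
    rewrite (le_trans (cabs_sum _ _ _)) //.
    apply: (@le_trans _ _ (\sum_(j < B) card * (b i / 2))).
      apply: ler_sum => j _; rewrite cabsM cabsX cabsX (cabs_prim_root wp) !expr1n mulr1.
      have := clip_mean i (beta1 j); rewrite cbeta ai.
      by rewrite /card rmorph_nat.
    by rewrite sumr_const card_ord [leRHS]mulr_natl.
  have := cabs_dist (card * b i)%:C (\sum_e sgn R e i * hat e i).
  rewrite cabsB cabs_real ger0_norm; last by rewrite mulr_ge0 // ltW.
  by lra.
(* If every pattern failed, summing over all of them would contradict [hat_mean]. *)
have [e he] : exists e, \sum_(i < L | (a <= i)%N) d i * (b i / 2) <=
    \sum_(i < L | (a <= i)%N) d i * cabs (hat e i).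
  apply: contrapT => /forallNP h.
  have : card * \sum_(i < L | (a <= i)%N) d i * (b i / 2) <=
      \sum_e \sum_(i < L | (a <= i)%N) d i * cabs (hat e i).
    rewrite exchange_big /= mulr_sumr; apply: ler_sum => i ai.
    by rewrite -mulr_sumr mulrCA ler_wpM2l // hat_mean.
  apply/negP; rewrite -ltNge.
  have -> : card * \sum_(i < L | (a <= i)%N) d i * (b i / 2) =
      \sum_(e : {ffun 'I_L -> bool}) \sum_(i < L | (a <= i)%N) d i * (b i / 2).
    by rewrite sumr_const mulr_natl cardT -cardE.
  apply: ltr_sum => [|e _]; last by rewrite ltNge; apply/negP; exact: h.
  by apply/hasP; exists [ffun=> true]; rewrite ?mem_index_enum.
have [P [P1 P2 P3 P4 P5]] := vallee_poussin s wp A0 AB (leqnn B) (fun j => soft_clip_le2 (sign_sum (beta j) e)).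
(* The quotient equals 6 + 6/n + 4/n^2. *)
have K11 : (A + B)%:R / A%:R <= 11 :> R.
  rewrite ler_pdivrMr ?ltr0n // -natrM ler_nat /B /L /a /A; lia.
exists P.
  split.
  - by move=> m m1; apply: P1; rewrite /s /a /A; lia.
  - by move=> m m1; apply: P2; rewrite /s /B /L /a /A; lia.
  - move=> z zl; rewrite (le_trans (P4 z zl)) // ler_pM ?divr_ge0 ?exprn_ge0 ?cabs_ge0 //.
    by rewrite ler_wiXn2l ?cabs_ge0 // /s /a /A; lia.
  - move=> z zl; rewrite (le_trans (P5 z zl)) // ler_pM ?divr_ge0 ?exprn_ge0 ?cabs_ge0 //.
    by rewrite ler_weXn2l // /s /B /L /a /A; lia.
rewrite !big_geq_mkord /=; apply: le_trans he _.
by apply: ler_sum => i ai; rewrite P3 //; rewrite /s /B /L /a /A in ai *; have := ltn_ord i; rewrite /L; lia.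
Qed.

End RandomBlock.

(** * The spaces l_p in terms of bounded partial sums *)

Section SequenceSpaces.
Variable R : realType.
Implicit Types (a : nat -> R[i]) (u : nat -> R).

Lemma nneseries_ltyP u k : (forall n, 0 <= u n) ->
  (\sum_(k <= n <oo) (u n)%:E < +oo)%E <->
  exists C : R, forall N, \sum_(k <= n < N) u n <= C.
Proof.
move=> u0; split=> [h|[C hC]].
  have s0 : (0 <= \sum_(k <= n <oo) (u n)%:E)%E.
    by apply: nneseries_ge0 => n _ _; rewrite lee_fin.
  exists (fine (\sum_(k <= n <oo) (u n)%:E)%E) => N.
  rewrite -lee_fin fineK; last by rewrite ge0_fin_numE.
  rewrite -sumEFin; apply: nneseries_lim_ge => n _ _; by rewrite lee_fin.
apply: le_lt_trans (ltry C); apply: lime_le.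
  by apply: is_cvg_nneseries => n _ _; rewrite lee_fin.
by apply: nearW => N; rewrite sumEFin lee_fin.
Qed.

Lemma ell_finP (p : R) a : 0 < p ->
  ell p%:E a <-> exists C : R, forall N, \sum_(0 <= m < N) cabs (a m) `^ p <= C.
Proof.
move=> p0; rewrite -nneseries_ltyP; last by move=> n; exact: powR_ge0.
rewrite /ell /= Lnorm_counting //.
have -> : (\sum_(0 <= k <oo) (`|(cabs (a k))%:E| `^ p)%E)%E =
    (\sum_(0 <= k <oo) (cabs (a k) `^ p)%:E)%E.
  apply: eq_eseriesr => k _; rewrite gee0_abs ?lee_fin ?cabs_ge0 //.
split; last exact: poweR_lty.
by apply: lty_poweRy; rewrite invr_eq0 gt_eqF.
Qed.

Lemma counting_set1 (k : nat) : counting [set k] = 1%E :> \bar R.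
Proof. by rewrite /counting asboolT //= fset_set1 finmap.cardfs1. Qed.

(** Points have counting measure 1, so a null set is empty. *)
Lemma ae_counting (P : set nat) :
  (\forall x \ae @counting nat R, P x) -> forall x, P x.
Proof.
move=> [A [mA A0 sub]] x; apply: contrapT => nP.
have : (counting [set x] <= counting A :> \bar R)%E.
  by apply: le_measure; rewrite ?inE // => _ ->; exact: sub.
by rewrite A0 counting_set1 lee_fin ler10.
Qed.

Lemma ell_inftyP a :
  ell +oo%E a <-> exists C : R, forall m, cabs (a m) <= C.
Proof.
rewrite /ell /= unlock.
(* The norm for exponent infinity is defined by cases on whether the whole space has positive
   measure. *)
have -> : (0 < @counting nat R setT)%E.
  apply: (@lt_le_trans _ _ (counting [set 0%N])).
    by rewrite counting_set1 lte_fin ltr01.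
  by apply: le_measure; rewrite ?inE.
split=> [h|[C hC]].
  set s := ess_sup _ _ in h.
  have hs m : ((cabs (a m))%:E <= s)%E.
    have := ae_counting (ess_sup_ge (@counting nat R) (abse \o (fun m => (cabs (a m))%:E))) m.
    by rewrite /= ger0_norm ?cabs_ge0.
  exists (fine s) => m; rewrite -lee_fin fineK //.
  by rewrite ge0_fin_numE // (le_trans _ (hs 0%N)) // lee_fin cabs_ge0.
apply: le_lt_trans (ltry C); apply/ess_supP; apply: nearW => m /=.
by rewrite lee_fin ger0_norm ?cabs_ge0.
Qed.

End SequenceSpaces.

(** * Block conditions for multipliers *)

Section Multipliers.
Variable R : realType.
Implicit Types (a lam : nat -> R[i]) (n m : nat).

Definition wt n m : R := expR (n%:R ^+ 2) * block_radius R n ^- m.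

Lemma wt_gt0 n m : (2 <= n)%N -> 0 < wt n m.
Proof. by move=> n2; rewrite mulr_gt0 ?expR_gt0 // invr_gt0 exprn_gt0 // block_radius_gt0. Qed.

Lemma wcoefE lam n m : wcoef lam n m = cabs (lam m) * wt n m.
Proof. by rewrite /wcoef mulrA. Qed.

Lemma wcoef_ge0 lam n m : (2 <= n)%N -> 0 <= wcoef lam n m.
Proof. by move=> n2; rewrite wcoefE mulr_ge0 ?cabs_ge0 // ltW // wt_gt0. Qed.

Lemma sum_blocks (u : nat -> R) N : (2 <= N)%N ->
  \sum_(2 <= n < N) \sum_((n ^ 4).+1 <= m < (n.+1 ^ 4).+1) u m =
  \sum_((2 ^ 4).+1 <= m < (N ^ 4).+1) u m.
Proof.
elim: N => // N IH; rewrite leq_eqVlt => /predU1P[<-|N2]; first by rewrite !big_geq.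
rewrite big_nat_recr //= IH // -big_cat_nat //= ltnS leq_exp2r //.
Qed.

(** Parseval on the circle of the block radius, where |f| <= M e^(n^2); the sum up to the end of the
    block contains the block. *)
Lemma taylor_block a : taylor_coefs (Hinfty (@weight R)) a ->
  exists2 M : R, 0 < M & forall n, (2 <= n)%N ->
    \sum_((n ^ 4).+1 <= m < (n.+1 ^ 4).+1) (cabs (a m) / (M * wt n m)) ^+ 2 <= 1.
Proof.
move=> [f [_ [M0 hM0]] af]; pose M := `|M0| + 1.
have M1 : 0 < M by rewrite ltr_wpDl.
exists M => // n n2; have r0 := block_radius_gt0 R n2; have r1 := block_radius_lt1 R n2.
have rr : 0 <= block_radius R n < 1 by rewrite r1 ltW.
have fB z : cabs z = block_radius R n -> cabs (f z) <= M * expR (n%:R ^+ 2).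
  move=> zr; have zd : disc z by rewrite /disc; change (cabs z < 1); rewrite zr.
  have := hM0 _ (ex_intro2 _ _ z zd erefl).
  rewrite zr weight_block_radius // expRN ler_pdivrMl ?expR_gt0 // mulrC => h.
  apply: (le_trans h); rewrite ler_wpM2r ?expR_ge0 // /M.
  by rewrite (le_trans (ler_norm _)) // lerDl.
have e0 : 0 < M * expR (n%:R ^+ 2) by rewrite mulr_gt0 ?expR_gt0.
have h : \sum_(m < (n.+1 ^ 4).+1) (cabs (a m) * block_radius R n ^+ m) ^+ 2 /
    (M * expR (n%:R ^+ 2)) ^+ 2 <= 1.
  rewrite -mulr_suml ler_pdivrMr ?exprn_gt0 // mul1r.
  exact: parseval_sum_on_disc rr af fB.
apply: le_trans h; rewrite -(big_mkord xpredT (fun m =>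
  (cabs (a m) * block_radius R n ^+ m) ^+ 2 / (M * expR (n%:R ^+ 2)) ^+ 2)).
rewrite [leRHS](@big_cat_nat _ _ _ (n ^ 4).+1) //=; last by rewrite ltnS leq_exp2r.
rewrite (eq_bigr (fun m => (cabs (a m) * block_radius R n ^+ m) ^+ 2 / (M * expR (n%:R ^+ 2)) ^+ 2)).
  by rewrite lerDr sumr_ge0 // => i _; rewrite divr_ge0 ?sqr_ge0.
move=> m _; rewrite -expr_div_n; congr (_ ^+ 2); rewrite /wt.
by rewrite !invfM invrK; ring.
Qed.

Variables (lam : nat -> R[i]).
Local Notation c := (wcoef lam).
Local Notation mult := (multipliers (taylor_coefs (Hinfty (@weight R)))).

(** The common argument for finite p: the first hypothesis on [T] is the Hoelder bound that gives
    sufficiency, the second provides nearly extremal block polynomials for necessity. *)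
Lemma multipliers_sumP (p K kappa : R) (T : nat -> R) : 1 <= p -> 0 < kappa ->
  (forall n (b : nat -> R), (2 <= n)%N -> (forall m, 0 <= b m) ->
    \sum_((n ^ 4).+1 <= m < (n.+1 ^ 4).+1) b m ^+ 2 <= 1 ->
    \sum_((n ^ 4).+1 <= m < (n.+1 ^ 4).+1) (c n m * b m) `^ p <= T n) ->
  (forall n, (2 <= n)%N -> exists2 P, block_poly K n P &
    kappa * T n <= \sum_((n ^ 4).+1 <= m < (n.+1 ^ 4).+1) (c n m * cabs P`_m) `^ p) ->
  mult (ell p%:E) lam <-> exists C : R, forall N, \sum_(2 <= n < N) T n <= C.
Proof.
move=> p1 k0 H1 H2; have p0 : 0 < p by lra.
split=> [lamM|[C hC] a aT].
  have [P PK] : {P : nat -> {poly R[i]} & forall n, (2 <= n)%N -> block_poly K n (P n) /\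
      kappa * T n <= \sum_((n ^ 4).+1 <= m < (n.+1 ^ 4).+1) (c n m * cabs (P n)`_m) `^ p}.
    apply: (choice (P := fun n Q => (2 <= n)%N -> block_poly K n Q /\
      kappa * T n <= \sum_((n ^ 4).+1 <= m < (n.+1 ^ 4).+1) (c n m * cabs Q`_m) `^ p)).
    move=> n; have [n2|n2] := leqP 2 n; last by exists 0.
    by have [Q h1 h2] := H2 n n2; exists Q.
  (* The multiplier is tested on the function glued from the blocks of one parity; the two bounds
     are added afterwards. *)
  have parity e : exists C : R, forall N, \sum_(2 <= n < N | odd n == e) kappa * T n <= C.
    have [a aT aE] := blocks_taylor_coefs e (fun n hn => proj1 (PK n hn)).
    have /(ell_finP _ p0)[C hC] := lamM a aT.
    exists C => N.
    have [N2|N2] := leqP 2 N; last first.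
      rewrite big_geq ?(ltnW N2) //; apply: le_trans (hC 0%N).
      by rewrite big_geq.
    apply: le_trans (hC (N ^ 4).+1).
    rewrite [leRHS](@big_cat_nat _ _ _ (2 ^ 4).+1) //=; last by rewrite ltnS leq_exp2r.
    rewrite -sum_blocks //.
    apply: (@le_trans _ _ (\sum_(2 <= n < N) \sum_((n ^ 4).+1 <= m < (n.+1 ^ 4).+1)
        cabs (lam m * a m) `^ p)); last first.
      by rewrite lerDr sumr_ge0 // => i _; exact: powR_ge0.
    rewrite big_mkcond /= big_nat_cond [leRHS]big_nat_cond.
    apply: ler_sum => n /andP[/andP[n2 _] _]; case: eqP => [ne|_]; last first.
      by apply: sumr_ge0 => m _; exact: powR_ge0.
    rewrite (le_trans (proj2 (PK n n2))) // le_eqVlt; apply/orP; left; apply/eqP.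
    apply: eq_big_nat => m nm; congr (_ `^ _); rewrite (aE n m n2 ne nm).
    rewrite !cabsM cabs_real ger0_norm ?(ltW (wt_gt0 m n2)) //.
    by rewrite wcoefE /wt !mulrA.
  have [C1 h1] := parity true; have [C2 h2] := parity false.
  exists ((C1 + C2) / kappa) => N; rewrite ler_pdivlMr // mulrC mulr_sumr.
  rewrite (bigID (fun n => odd n == true)) /= lerD //.
  by rewrite (eq_bigl (fun n => odd n == false)) // => n; case: (odd n).
have [M M0 hM] := taylor_block aT.
apply/(ell_finP _ p0).
(* Indices up to 16 precede all blocks and are counted separately; the range is then enlarged to end
   with a complete block. *)
exists (\sum_(0 <= m < (2 ^ 4).+1) cabs (lam m * a m) `^ p + M `^ p * C) => N.
have NN : (N <= (N.+2 ^ 4).+1)%N.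
  have : (N.+2 ^ 1 <= N.+2 ^ 4)%N by rewrite leq_pexp2l.
  by rewrite expn1; lia.
apply: (@le_trans _ _ (\sum_(0 <= m < (N.+2 ^ 4).+1) cabs (lam m * a m) `^ p)).
  rewrite [leRHS](big_cat_nat (leq0n N) NN) /= lerDl sumr_ge0 // => i _.
  exact: powR_ge0.
rewrite (@big_cat_nat _ _ _ (2 ^ 4).+1) //=; last by rewrite ltnS leq_exp2r.
rewrite lerD2l -sum_blocks //.
apply: (@le_trans _ _ (\sum_(2 <= n < N.+2) M `^ p * T n)); last first.
  by rewrite -mulr_sumr ler_wpM2l ?powR_ge0.
rewrite big_nat_cond [leRHS]big_nat_cond; apply: ler_sum => n /andP[/andP[n2 _] _].
have b0 m : 0 <= cabs (a m) / (M * wt n m).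
  by rewrite divr_ge0 ?cabs_ge0 // ltW // mulr_gt0 // wt_gt0.
apply: le_trans (ler_wpM2l (powR_ge0 _ _) (H1 n _ n2 b0 (hM n n2))).
rewrite mulr_sumr; apply: ler_sum => m _.
have cb0 : 0 <= c n m * (cabs (a m) / (M * wt n m)).
  by apply: mulr_ge0 => //; exact: wcoef_ge0.
rewrite -(powRM _ (ltW M0) cb0) le_eqVlt; apply/orP; left; apply/eqP.
congr (_ `^ _); rewrite cabsM wcoefE; field.
by rewrite !gt_eqF // wt_gt0.
Qed.

Lemma bigmax_block_ub n m : (n ^ 4 < m <= n.+1 ^ 4)%N ->
  c n m <= \big[Num.max/0]_((n ^ 4).+1 <= m < (n.+1 ^ 4).+1) c n m.
Proof.
by move=> nm; apply: le_bigmax_seq => //; rewrite mem_index_iota.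
Qed.

Lemma bigmax_block_ge0 n : 0 <= \big[Num.max/0]_((n ^ 4).+1 <= m < (n.+1 ^ 4).+1) c n m.
Proof. exact: bigmax_ge_id. Qed.

Lemma bigmax_block_attained n : (2 <= n)%N ->
  exists2 m, (n ^ 4 < m <= n.+1 ^ 4)%N &
    \big[Num.max/0]_((n ^ 4).+1 <= m < (n.+1 ^ 4).+1) c n m = c n m.
Proof.
move=> n2; set X := \big[Num.max/0]_(_ <= _ < _) _.
have [h|h] : X = 0 \/ exists2 m, m \in index_iota (n ^ 4).+1 (n.+1 ^ 4).+1 & X = c n m.
- rewrite /X; elim: (index_iota _ _) => [|i s IH]; first by left; rewrite big_nil.
  rewrite big_cons; case: (leP (c n i)) => _; last by right; exists i; rewrite ?mem_head.
  case: IH => [->|[m ms ->]]; first by left.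
  by right; exists m; rewrite // inE ms orbT.
(* If the maximum is the default 0, all nonnegative c vanish on the block and its last index
   serves. *)
- have nm : (n ^ 4 < n.+1 ^ 4 <= n.+1 ^ 4)%N by rewrite leqnn ltn_exp2r // ltnSn.
  exists (n.+1 ^ 4)%N => //; apply/eqP; rewrite eq_le bigmax_block_ub // andbT.
  by rewrite -/X h wcoef_ge0.
- by case: h => m; rewrite mem_index_iota => ms ->; exists m.
Qed.

Lemma block_poly_Xn n m : (2 <= n)%N -> (n ^ 4 < m <= n.+1 ^ 4)%N ->
  block_poly (11 : R) n 'X^m.
Proof.
move=> n2 /andP[nm mn].
have h1 : (n.-1 ^ 4 < m)%N by rewrite (leq_ltn_trans _ nm) // leq_exp2r // leq_pred.
have h2 : (n.+1 ^ 4 <= (n + 2) ^ 4)%N by rewrite leq_exp2r //; lia.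
have h3 : (n.+1 ^ 4 <= (n + 3) ^ 4)%N by rewrite leq_exp2r //; lia.
split=> [k km|k km|z z1|z z1].
- by rewrite coefXn ltn_eqF // (leq_ltn_trans km).
- by rewrite coefXn gtn_eqF // (leq_ltn_trans _ km) // (leq_trans mn).
- rewrite hornerXn cabsX (@le_trans _ _ (cabs z ^+ (n.-1 ^ 4))) //.
    by rewrite ler_wiXn2l ?cabs_ge0 // ltnW.
  by rewrite ler_peMl ?exprn_ge0 ?cabs_ge0 // ler1n.
- rewrite hornerXn cabsX (@le_trans _ _ (cabs z ^+ ((n + 3) ^ 4))) //.
    by rewrite ler_weXn2l // (leq_trans mn).
  by rewrite ler_peMl ?exprn_ge0 ?cabs_ge0 // ler1n.
Qed.

(** Each b_m is at most 1, so b_m^p <= b_m^2 for p >= 2; conversely the monomial at the maximizing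
    index is a block polynomial. *)
Lemma multipliers_ge2P (p : R) : 2 <= p ->
  mult (ell p%:E) lam <-> exists C : R, forall N, \sum_(2 <= n < N)
    (\big[Num.max/0]_((n ^ 4).+1 <= m < (n.+1 ^ 4).+1) c n m) `^ p <= C.
Proof.
move=> p2; have p0 : 0 < p by lra.
apply: (@multipliers_sumP p 11 1) => // [|n b n2 b0 b1|n n2].
- by lra.
- set X := \big[Num.max/0]_(_ <= _ < _) _.
  apply: (@le_trans _ _ (\sum_((n ^ 4).+1 <= m < (n.+1 ^ 4).+1) X `^ p * b m ^+ 2)); last first.
    by rewrite -mulr_sumr ler_piMr ?powR_ge0.
  rewrite big_nat_cond [leRHS]big_nat_cond; apply: ler_sum => m /andP[nm _].
  have bm1 : b m <= 1.
    rewrite -(@ler_pXn2r _ 2) ?nnegrE // expr1n; apply: le_trans b1.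
    rewrite (bigD1_seq m) ?mem_index_iota ?iota_uniq //= lerDl sumr_ge0 // => i _.
    exact: sqr_ge0.
  rewrite powRM ?wcoef_ge0 // ler_pM ?powR_ge0 //.
    rewrite ge0_ler_powR ?nnegrE ?wcoef_ge0 ?bigmax_block_ge0 //; first by lra.
    exact: bigmax_block_ub.
  have [->|bm0] := eqVneq (b m) 0; first by rewrite powR0 ?gt_eqF // expr0n.
  rewrite -powR_mulrn // ger_powR // bm1 andbT lt_def bm0 /=; exact: b0.
- have [m nm ->] := bigmax_block_attained n2; exists 'X^m; first exact: block_poly_Xn.
  rewrite (bigD1_seq m) ?mem_index_iota ?iota_uniq //= coefXn eqxx cabs1 mulr1 mul1r.
  by rewrite lerDl sumr_ge0 // => i _; exact: powR_ge0.
Qed.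

Lemma multipliers_inftyP :
  mult (ell +oo%E) lam <-> exists C : R, forall n, (2 <= n)%N ->
    \big[Num.max/0]_((n ^ 4).+1 <= m < (n.+1 ^ 4).+1) c n m <= C.
Proof.
split=> [lamM|[C hC] a aT].
  have [k hk] : {k : nat -> nat & forall n, (2 <= n)%N -> (n ^ 4 < k n <= n.+1 ^ 4)%N /\
      \big[Num.max/0]_((n ^ 4).+1 <= m < (n.+1 ^ 4).+1) c n m = c n (k n)}.
    apply: (choice (P := fun n k => (2 <= n)%N -> (n ^ 4 < k <= n.+1 ^ 4)%N /\
      \big[Num.max/0]_((n ^ 4).+1 <= m < (n.+1 ^ 4).+1) c n m = c n k)).
    move=> n; have [n2|n2] := leqP 2 n; last by exists 0%N.
    by have [m h1 h2] := bigmax_block_attained n2; exists m.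
  have parity e : exists C : R, forall n, (2 <= n)%N -> odd n = e -> c n (k n) <= C.
    have [a aT aE] := blocks_taylor_coefs e
      (fun n hn => block_poly_Xn hn (proj1 (hk n hn))).
    have /ell_inftyP[C hC] := lamM a aT.
    exists C => n n2 ne; apply: le_trans (hC (k n)).
    rewrite (aE n (k n) n2 ne (proj1 (hk n n2))) coefXn eqxx mulr1 cabsM cabs_real.
    by rewrite wcoefE ler_wpM2l ?cabs_ge0 // ler_norm.
  have [C1 h1] := parity true; have [C2 h2] := parity false.
  exists (Num.max C1 C2) => n n2; rewrite (proj2 (hk n n2)) le_max.
  by case: (boolP (odd n)) => [/(h1 n n2) -> //|/negbTE /(h2 n n2) ->]; rewrite orbT.
have [M M0 hM] := taylor_block aT; apply/ell_inftyP.
exists (M * C + \sum_(0 <= m < (2 ^ 4).+1) cabs (lam m * a m)) => m.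
have C0 : 0 <= C by apply: le_trans (hC 2%N isT); exact: bigmax_block_ge0.
have [m16|m16] := leqP m (2 ^ 4)%N.
  rewrite (bigD1_seq m) ?mem_index_iota ?iota_uniq //= addrCA lerDl.
  rewrite addr_ge0 ?mulr_ge0 ?(ltW M0) // sumr_ge0 // => i _; exact: cabs_ge0.
have [n n2 nm] : exists2 n, (2 <= n)%N & (n ^ 4 < m <= n.+1 ^ 4)%N.
  have ex : exists k, (m <= k ^ 4)%N.
    by exists m; case: (m) => // i; rewrite -{1}[i.+1]expn1 leq_pexp2l.
  (* The block of m is found from the least k + 1 with m <= (k + 1)^4; m > 16 forces k >= 2. *)
  case: (ex_minnP ex) => [[|k] mk kmin]; first by move: mk m16; lia.
  exists k; last by rewrite mk andbT ltnNge; apply/negP => /kmin; rewrite ltnn.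
  rewrite leqNgt; apply/negP => k2; suff : (k.+1 ^ 4 <= 2 ^ 4)%N by move: mk m16; lia.
  by rewrite leq_exp2r.
apply: (@le_trans _ _ (M * C)); last first.
  by rewrite lerDl sumr_ge0 // => i _; exact: cabs_ge0.
have wt0 := wt_gt0 m n2.
have b0 : 0 <= cabs (a m) / (M * wt n m) by rewrite divr_ge0 ?cabs_ge0 // ltW // mulr_gt0.
have b1 : cabs (a m) / (M * wt n m) <= 1.
  rewrite -(@ler_pXn2r _ 2) ?nnegrE // expr1n; apply: le_trans (hM n n2).
  rewrite (bigD1_seq m) ?mem_index_iota ?iota_uniq //= lerDl sumr_ge0 // => i _.
  exact: sqr_ge0.
have -> : cabs (lam m * a m) = M * (c n m * (cabs (a m) / (M * wt n m))).
  by rewrite cabsM wcoefE; field; rewrite !gt_eqF.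
rewrite ler_wpM2l ?(ltW M0) //.
apply: (@le_trans _ _ (c n m)); first by rewrite ler_piMr ?wcoef_ge0.
exact: le_trans (bigmax_block_ub nm) (hC n n2).
Qed.

(** Young's inequality for p and p / (p - 1); p = 1 is separate because the conjugate exponent is
    infinite. It upgrades the linear estimate of [block_poly_random] to p-th powers. *)
Lemma young_powR (p x y : R) : 1 <= p -> 0 <= x -> 0 <= y ->
  y `^ (p - 1) * x <= p^-1 * x `^ p + (1 - p^-1) * y `^ p.
Proof.
move=> p1 x0 y0; have [->|p1'] := eqVneq p 1.
  by rewrite subrr powRr0 invr1 subrr mul0r addr0 !mul1r powRr1.
have pm : 0 < p - 1 by rewrite subr_gt0 lt_def p1' p1.
have p0 : 0 < p by lra.
have := conjugate_powR (p := p) (q := p / (p - 1)) x0 (powR_ge0 y (p - 1)) p0.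
rewrite divr_gt0 // => /(_ isT) h; have pq : p^-1 + (p / (p - 1))^-1 = 1 by field; rewrite ?gt_eqF.
have := h pq.
rewrite -powRrM mulrCA divff ?mulr1 ?gt_eqF // => h'.
rewrite mulrC (le_trans h') //.
by rewrite le_eqVlt; apply/orP; left; apply/eqP; field; rewrite ?gt_eqF.
Qed.

Lemma multipliers_lt2P (p : R) : 1 <= p < 2 ->
  mult (ell p%:E) lam <-> exists C : R, forall N, \sum_(2 <= n < N)
    (\sum_((n ^ 4).+1 <= m < (n.+1 ^ 4).+1) c n m `^ (2 * p / (2 - p))) `^ ((2 - p) / 2)
    <= C.
Proof.
move=> /andP[p1 p2]; have p0 : 0 < p by lra.
have p20 : 0 < 2 - p by lra.
set q := 2 * p / (2 - p).
have q0 : 0 < q by rewrite divr_gt0 // mulr_gt0.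
apply: (@multipliers_sumP p 11 (2^-1 `^ p)) => // [n b n2 b0 b1|n n2].
- set S := \sum_(_ <= _ < _) _ `^ q.
  have S0 : 0 <= S by apply: sumr_ge0 => m _; exact: powR_ge0.
  have [Sz|Sn] := eqVneq S 0.
    rewrite big_nat_cond big1 ?powR_ge0 // => m /andP[nm _].
    suff -> : c n m = 0 by rewrite mul0r powR0 ?gt_eqF.
    apply: (@powR_eq0_eq0 _ _ q); apply/eqP; rewrite eq_le powR_ge0 andbT -Sz /S.
    rewrite (bigD1_seq m) ?mem_index_iota ?iota_uniq //= lerDl sumr_ge0 // => i _.
    exact: powR_ge0.
  have Sp : 0 < S by rewrite lt_def Sn.
  set t := S `^ ((2 - p) / 2); have t0 : 0 < t by exact: powR_gt0.
  (* Young's inequality with exponents 2 / (2 - p) and 2 / p, normalized by t so that summation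
     yields at most t; this is Hoelder's inequality on the block. *)
  have key m : (c n m * b m) `^ p <=
      t * ((2 - p) / 2 * (c n m `^ q / S) + p / 2 * b m ^+ 2).
    have c0 := wcoef_ge0 lam m n2.
    rewrite powRM // -ler_pdivrMl // mulrA [t^-1 * _]mulrC.
    have -> : b m ^+ 2 = (b m `^ p) `^ (2 / p).
      by rewrite -powRrM mulrC divfK ?gt_eqF // powR_mulrn.
    have -> : c n m `^ q / S = (c n m `^ p / t) `^ (2 / (2 - p)).
      rewrite powRM ?powR_ge0 ?invr_ge0 ?(ltW t0) // -powRrM.
      rewrite [p * _](_ : _ = q); last by rewrite /q; field; rewrite gt_eqF.
      have -> : t^-1 = S `^ (- ((2 - p) / 2)) by rewrite powRN.
      rewrite -powRrM -(powR_inv1 (ltW Sp)); congr (_ * _ `^ _).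
      by field; rewrite gt_eqF.
    have := @conjugate_powR _ (c n m `^ p / t) (b m `^ p) (2 / (2 - p)) (2 / p).
    rewrite divr_ge0 ?powR_ge0 ?(ltW t0) // => /(_ isT isT).
    rewrite !divr_gt0 // => /(_ isT isT) h; apply: le_trans (h _) _.
      by field; rewrite !gt_eqF.
    by rewrite le_eqVlt; apply/orP; left; apply/eqP; field; rewrite !gt_eqF.
  apply: (le_trans (ler_sum _ (fun m _ => key m))).
  rewrite -mulr_sumr big_split /= -!mulr_sumr -mulr_suml -/S divff // mulr1.
  by rewrite ler_piMr ?(ltW t0) //; nra.
- set S := \sum_(_ <= _ < _) _ `^ q.
  have S0 : 0 <= S by apply: sumr_ge0 => m _; exact: powR_ge0.
  have [Sz|Sn] := eqVneq S 0.
    exists 0.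
      by split=> [m _|m _|z _|z _]; rewrite ?coef0 // horner0 cabs0 mulr_ge0 ?exprn_ge0 ?cabs_ge0.
    rewrite Sz powR0 ?mulr0 ?sumr_ge0 // => [m _|]; first exact: powR_ge0.
    by rewrite gt_eqF // divr_gt0.
  have Sp : 0 < S by rewrite lt_def Sn.
  (* The extremal vector for Hoelder's inequality, of l^2-norm 1. *)
  pose b m := c n m `^ (q / 2) * S `^ (- 2^-1).
  have b0 m : 0 <= b m by rewrite mulr_ge0 ?powR_ge0.
  pose y m := c n m * b m / 2.
  have c0 m := wcoef_ge0 lam m n2.
  have y0 m : 0 <= y m by apply: divr_ge0 => //; exact: mulr_ge0.
  (* These weights turn the linear sum of d b / 2 into the sum of y^p. *)
  have d0 m : 0 <= y m `^ (p - 1) * c n m.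
    by apply: mulr_ge0 => //; exact: powR_ge0.
  have b1 : \sum_((n ^ 4).+1 <= m < (n.+1 ^ 4).+1) b m ^+ 2 <= 1.
    rewrite (eq_bigr (fun m => c n m `^ q * S^-1)); first by rewrite -mulr_suml -/S divff.
    move=> m _; rewrite /b exprMn -!powR_mulrn ?powR_ge0 // -!powRrM.
    by rewrite divfK // mulNr mulVf // powR_inv1 // ltW.
  have [P PB hP] := block_poly_random n2 b0 d0 b1.
  exists P => //.
  (* By 1 + q / 2 = q / p, y^p is proportional to c^q. *)
  have yE m : y m `^ p = 2^-1 `^ p * (S `^ (- (p / 2)) * c n m `^ q).
    rewrite /y mulrC powRM ?invr_ge0 //; last exact: mulr_ge0.
    congr (_ * _).
    rewrite /b mulrA [c n m * _](_ : _ = c n m `^ (q / p)); last first.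
      rewrite -{1}[c n m]powRr1 // -powRD.
        by congr (_ `^ _); rewrite /q; field; rewrite !gt_eqF.
      by rewrite gt_eqF // addr_gt0 // divr_gt0.
    rewrite powRM ?powR_ge0 // -!powRrM divfK ?gt_eqF // mulrC; congr (_ * _).
    by congr (_ `^ _); field.
  have -> : 2^-1 `^ p * S `^ ((2 - p) / 2) = \sum_((n ^ 4).+1 <= m < (n.+1 ^ 4).+1) y m `^ p.
    under eq_bigr do rewrite yE.
    rewrite -!mulr_sumr -/S; congr (_ * _).
    rewrite -{3}[S]powRr1 // -powRD ?Sn ?implybT //; congr (_ `^ _).
    by field.
  have h : \sum_((n ^ 4).+1 <= m < (n.+1 ^ 4).+1) y m `^ p <=
      \sum_((n ^ 4).+1 <= m < (n.+1 ^ 4).+1)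
        (p^-1 * (c n m * cabs P`_m) `^ p + (1 - p^-1) * y m `^ p).
    apply: (@le_trans _ _ (\sum_((n ^ 4).+1 <= m < (n.+1 ^ 4).+1) y m `^ (p - 1) * c n m * cabs P`_m)).
      apply: le_trans hP; rewrite le_eqVlt; apply/orP; left; apply/eqP.
      by apply: eq_bigr => m _; rewrite -(mulr_powRB1 (y0 m) p0) /y; field.
    by apply: ler_sum => m _; rewrite -mulrA young_powR // mulr_ge0 ?cabs_ge0.
  (* The part (1 - 1/p) of the sum of y^p is absorbed on the left. *)
  rewrite big_split /= -!mulr_sumr in h.
  by rewrite -(@ler_pM2l _ p^-1) ?invr_gt0 //; lra.
Qed.

End Multipliers.

Theorem proposition5p2 (R : realType) :
  [/\ forall p : R, 1 <= p < 2 ->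
        multipliers (taylor_coefs (Hinfty (@weight R))) (ell p%:E) =
        [set lam |
          ((\sum_(2 <= n <oo)
              ((\sum_((n ^ 4).+1 <= m < ((n.+1) ^ 4).+1)
                  wcoef lam n m `^ (2 * p / (2 - p))) `^ ((2 - p) / 2))%:E)
             `^ (1 / p) < +oo)%E],
      forall p : R, 2 <= p ->
        multipliers (taylor_coefs (Hinfty (@weight R))) (ell p%:E) =
        [set lam |
          ((\sum_(2 <= n <oo)
              ((\big[Num.max/0]_((n ^ 4).+1 <= m < ((n.+1) ^ 4).+1)
                  wcoef lam n m) `^ p)%:E)
             `^ (1 / p) < +oo)%E] &
      multipliers (taylor_coefs (Hinfty (@weight R))) (ell +oo%E) =
        [set lam |
          (ereal_sup [set (\big[Num.max/0]_((n ^ 4).+1 <= m < ((n.+1) ^ 4).+1)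
                             wcoef lam n m)%:E | n in [set n | (2 <= n)%N]]
             < +oo)%E]].
Proof.
(* The outer exponent 1/p is positive and does not affect finiteness. *)
have poweR_ltyP (x : \bar R) (p : R) : 0 < p -> (x `^ (1 / p) < +oo)%E <-> (x < +oo)%E.
  move=> p0; split; last exact: poweR_lty.
  by apply: lty_poweRy; rewrite div1r invr_eq0 gt_eqF.
split=> [p p12|p p2|]; rewrite predeqE => lam /=.
- rewrite poweR_ltyP; last by lra.
  by rewrite nneseries_ltyP ?multipliers_lt2P // => n; exact: powR_ge0.
- rewrite poweR_ltyP; last by lra.
  by rewrite nneseries_ltyP ?multipliers_ge2P // => n; exact: powR_ge0.
- rewrite multipliers_inftyP; split=> [[C hC]|].
    apply: le_lt_trans (ltry C); apply: ge_ereal_sup => _ [n n2 <-].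
    by rewrite lee_fin hC.
  set s := ereal_sup _ => h.
  have hs n : (2 <= n)%N ->
      ((\big[Num.max/0]_((n ^ 4).+1 <= m < (n.+1 ^ 4).+1) wcoef lam n m)%:E <= s)%E.
    by move=> n2; apply: ereal_sup_ubound; exists n.
  exists (fine s) => n n2; rewrite -lee_fin fineK; first exact: hs.
  rewrite ge0_fin_numE //; apply: le_trans (hs 2%N isT).
  by rewrite lee_fin bigmax_block_ge0.
Qed.
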